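(* Let $\Omega$, $a$, $f$ be as in the context, and assume that $a\in C^1(\Omega)$, that $\frac{\partial a}{\partial s}(u,s)>0$ for all $(u,s)\in\Omega$, and that $a_+:[0,1]\to[0,\infty]$ is continuous. For $\varepsilon>0$ let $\sigma_r^\varepsilon$ denote the value $\sigma_r$ associated with the flux $a^\varepsilon(u,s)=a(u,s)+\varepsilon s$ on $\Omega$ (with the same $f$), and let $\sigma_s$ be the value associated with the original flux $a$. Then $$\lim_{\varepsilon\to0}\sigma_r^\varepsilon=\sigma_s .$$
   Context: $\Omega=\{(u,s)\in\mathbb R^2: u\in[0,1],\ \omega_-(u)<s<\omega_+(u)\}$, where $\omega_+:[0,1]\to(0,\infty]$ is lower semicontinuous and $\omega_-=-\omega_+$. The flux $a:\Omega\to\mathbb R$ is continuous, $a(u,-s)=-a(u,s)$, and $s\mapsto a(u,s)$ is increasing for every $u$. Put $a_\pm(u)=\lim_{s\to\omega_\pm(u)}a(u,s)\in[-\infty,\infty]$; it is assumed that $a_+(u)=\infty$ whenever $\omega_+(u)<\infty$. The reaction term satisfies $f\in C^1[0,1]$, $f(0)=f(1)=0$, $f(u)>0$ for $u\in(0,1)$. For a continuous flux $a:\Omega\to\mathbb R$ such that $a(u,-s)=-a(u,s)$, $s\mapsto a(u,s)$ is increasing for every $u$, and $a_+(u)=\infty$ whenever $\omega_+(u)<\infty$ (where $a_\pm(u)=\lim_{s\to\omega_\pm(u)}a(u,s)$), with $a\in C^1(\Omega)$ and $\partial a/\partial s>0$, let $\mathcal D=\{(u,v)\in[0,1]\times\mathbb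 R: a_-(u)<v<a_+(u)\}$ and let $g:\mathcal D\to\mathbb R$ be defined by $a(u,g(u,v))=v$. For $\sigma\ge0$, $(\alpha_\sigma,1]$ (with $\alpha_\sigma\in[0,1)$) denotes the maximal interval to the left of $1$ on which there is a (unique) function $V_\sigma\in C((\alpha_\sigma,1])\cap C^1((\alpha_\sigma,1))$ with $V_\sigma(1)=0$, $0<V_\sigma(u)<a_+(u)$ and $\dot V_\sigma(u)=\sigma-\frac{f(u)}{g(u,V_\sigma(u))}$ for $u\in(\alpha_\sigma,1)$; when $\alpha_\sigma=0$, $V_\sigma(0)=\lim_{u\to0^+}V_\sigma(u)$. Define $\sigma_r=\inf\{\sigma>0:\alpha_\sigma=0\text{ and }V_\sigma(0)=0\}$. Let $\mathcal H(u,V)=\frac1{g(u,V)}$ if $0<V<a_+(u)$ and $\mathcal H(u,V)=0$ if $V\ge a_+(u)$. When $a_+$ is continuous, for each $\sigma\ge0$ let $\mathcal V_\sigma\in C([0,1])\cap C^1((0,1))$ be the unique function, positive on $(0,1)$, with $\dot{\mathcal V}_\sigma=\sigma-f(u)\mathcal H(u,\mathcal V_\sigma)$ on $(0,1)$ and $\mathcal V_\sigma(1)=0$. Define $\sigma_s=\min\{\sigma\ge0:\mathcal V_\sigma(0)=0\}$. *)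

(* Defs.v *)
From HB Require Import structures.
From mathcomp Require Import all_boot all_order all_algebra.
From mathcomp Require Import all_classical all_reals all_analysis.

Set Implicit Arguments.
Unset Strict Implicit.
Unset Printing Implicit Defensive.

Import Order.TTheory GRing.Theory Num.Theory.
Import numFieldNormedType.Exports.

Local Open Scope classical_set_scope.
Local Open Scope ring_scope.

(* Functions living on a subset of R or of R^2 are represented by total
   functions; only their values on the subset matter below.  The function
   [omega] stands for omega_+, and omega_- is its opposite. *)

Section Calculus.
Context {R : realType}.
Implicit Types (A : set R) (f : R -> R) (x y l : R).

(* Derivative at x along the points of A: two-sided in the interior of an
   interval A, one-sided at its end-points. *)
Definition is_derive_within A f x l : Prop :=
  (f y - f x) / (y - x) @[y --> within A x^'] --> l.

Definition C1_on A f : Prop := exists f' : R -> R,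
  {within A, continuous f'} /\
  forall x, A x -> is_derive_within A f x (f' x).

Definition C1_oo f (l r : R) : Prop :=
  (forall x, x \in `]l, r[ -> derivable f x 1) /\
  {within `]l, r[, continuous (derive1 f)}.

(* The least element of A; an arbitrary value if there is none. *)
Definition minimum A : R := get (A `&` lbound A).

(* s tends to x from the left, for an extended real x; the case -oo is never
   used. *)
Definition ereal_at_left (x : \bar R) : set_system R :=
  match x with
  | r%:E%E => r^'-
  | +oo%E => pinfty_nbhs R
  | -oo%E => ninfty_nbhs R
  end.

End Calculus.

Section Flux.
Context {R : realType}.
Variable omega : R -> \bar R.

Definition Omega : set (R * R) :=
  [set p | p.1 \in `[0, 1] /\ (- omega p.1 < p.2%:E < omega p.1)%E].

(* As omega is lower semicontinuous, Omega is open in [0,1] x R; hence at u = 0 and u = 1 the derivative in u is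
   one-sided, while the derivative in s is always two-sided. *)
Definition C1_Omega (a : R -> R -> R) : Prop :=
  (exists au : R -> R -> R,
    {within Omega, continuous (fun p : R * R => au p.1 p.2)} /\
    forall u s, Omega (u, s) ->
      is_derive_within [set w | Omega (w, s)] (a^~ s) u (au u s)) /\
  (forall u s, Omega (u, s) -> derivable (a u) s 1) /\
  {within Omega, continuous (fun p : R * R => derive1 (a p.1) p.2)}.

Variable a : R -> R -> R.

Definition a_plus (u : R) : \bar R :=
  lim ((a u s)%:E @[s --> ereal_at_left (omega u)]).

(* The solution s of a(u, s) = v with (u, s) in Omega; meaningful only when
   a_-(u) < v < a_+(u). *)
Definition g (u v : R) : R := get [set s | Omega (u, s) /\ a u s = v].

(* Only used for v > 0. *)
Definition calH (u v : R) : R :=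
  if (v%:E < a_plus u)%E then (g u v)^-1 else 0.

Variable f : R -> R.

Definition is_V (sigma alpha : R) (V : R -> R) : Prop :=
  [/\ {within `]alpha, 1], continuous V},
      C1_oo V alpha 1,
      V 1 = 0 &
      forall u, u \in `]alpha, 1[ ->
        [/\ 0 < V u, ((V u)%:E < a_plus u)%E &
            derive1 V u = sigma - f u / g u (V u)]].

(* ]alpha_, 1] is the largest interval carrying a solution. *)
Definition alpha_ (sigma : R) : R :=
  minimum [set alpha | 0 <= alpha < 1 /\ exists V, is_V sigma alpha V].

Definition sigma_r : \bar R :=
  ereal_inf [set sigma%:E | sigma in [set sigma : R |
    [/\ 0 < sigma, alpha_ sigma = 0 &
        exists V, is_V sigma (alpha_ sigma) V /\
                  V u @[u --> 0^'+] --> (0 : R)]]].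

Definition is_calV (sigma : R) (V : R -> R) : Prop :=
  [/\ {within `[0, 1], continuous V},
      C1_oo V 0 1,
      V 1 = 0,
      (forall u, u \in `]0, 1[ -> 0 < V u) &
      forall u, u \in `]0, 1[ -> derive1 V u = sigma - f u * calH u (V u)].

Definition sigma_s : R :=
  minimum [set sigma | 0 <= sigma /\ exists V, is_calV sigma V /\ V 0 = 0].

End Flux.

(* Main.v *)
Require Import Defs.
From HB Require Import structures.
From mathcomp Require Import all_boot all_order all_algebra.
From mathcomp Require Import all_classical all_reals all_analysis.
From mathcomp Require Import ring lra.

Set Implicit Arguments.
Unset Strict Implicit.
Unset Printing Implicit Defensive.

Import Order.TTheory GRing.Theory Num.Theory.
Import numFieldNormedType.Exports.

Local Open Scope classical_set_scope.
Local Open Scope ring_scope.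

(** Write H = 1/g, extended by 0 above a_+.  The equation V' = sigma - f H(u, V)
    is dissipative when u decreases because H is nonincreasing in V, although H is
    neither bounded near V = 0 nor Lipschitz in V.  Dissipativity makes solutions of
    delayed equations V'(u) = sigma - f H(u, max (V(u + h), f/L)) a Cauchy family as
    h -> 0, which gives existence; for L large f/L is a subsolution, so that V >= f/L
    and the truncation disappears in the limit.  Dissipativity also gives a
    comparison principle with supersolutions.

    Let H^eps correspond to a + eps s; then H^eps >= H, so that every speed
    admissible for H^eps is admissible for H, hence sigma_r^eps >= sigma_s.
    Conversely V_{sigma_s} is a supersolution for H^eps and sigma_s + eta as soon as
    f (H^eps - H)(u, V_{sigma_s}) <= eta on (0, 1).  This holds for small eps: away
    from V = 0 by compactness, and where V is small because there
    H^eps <= (1 + eps/m) H with m a lower bound of da/ds near s = 0, while f H(u, V)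
    is bounded thanks to V >= f/L. *)

(** * Calculus on an interval *)

Section Calculus.
Context {R : realType}.
Implicit Types (D dD F dF : R -> R) (a b c e x y M : R).

Lemma nondecreasing_of_derive F dF a b : a <= b ->
  {within `[a, b], continuous F} ->
  (forall x, x \in `]a, b[ -> is_derive x 1 F (dF x)) ->
  (forall x, x \in `]a, b[ -> 0 <= dF x) -> F a <= F b.
Proof.
rewrite le_eqVlt => /predU1P[->//|ab] cF dFE dF0.
have [z zab E] := MVT ab dFE cF.
by rewrite -subr_ge0 E mulr_ge0 ?dF0 // subr_ge0 ltW.
Qed.

(** Backward maximum principle: a bound at the right end propagates to the left. If [D x] exceeded
    [M], let [c] be the infimum of the later points where [D] is at most [M]. On the way to [c] the
    derivative is nonnegative, so [D c] is at least [D x], hence above [M], and continuity at [c]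
    contradicts the choice of [c]. *)
Lemma le_of_barrier D dD a b M :
  {within `[a, b], continuous D} ->
  (forall x, x \in `]a, b[ -> is_derive x 1 D (dD x)) ->
  D b <= M ->
  (forall x, x \in `]a, b[ -> M < D x -> 0 <= dD x) ->
  forall x, x \in `[a, b] -> D x <= M.
Proof.
move=> cD dDE Db dD0 x xab; rewrite leNgt; apply/negP => Mx.
have /andP[ax xb] : a <= x <= b by rewrite in_itv in xab.
pose S := [set y | x <= y <= b /\ D y <= M].
have Sb : S b by rewrite /S /= xb lexx.
have hinf : has_inf S.
  by split; [exists b|exists x => y [/andP[]]].
pose c := inf S.
have xc : x <= c by apply: lb_le_inf; [exists b|move=> y [/andP[]]].
have cb : c <= b by apply: ge_inf => //; exact: hinf.2.
have cab : c \in `[a, b] by rewrite in_itv /= (le_trans ax xc) cb.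
have gtM y : x <= y -> y < c -> M < D y.
  move=> xy yc; rewrite ltNge; apply/negP => DyM.
  have : c <= y.
    by apply: ge_inf; [exact: hinf.2|split => //; rewrite xy (ltW (lt_le_trans yc cb))].
  by rewrite leNgt yc.
have Dxc : D x <= D c.
  have dDxc y : y \in `]x, c[ -> is_derive y 1 D (dD y).
    rewrite in_itv /= => /andP[xy yc].
    by apply: dDE; rewrite in_itv /= (le_lt_trans ax xy) (lt_le_trans yc cb).
  have cDxc : {within `[x, c], continuous D}.
    apply: continuous_subspaceW cD => y /=; rewrite !in_itv /= => /andP[xy yc].
    by rewrite (le_trans ax xy) (le_trans yc cb).
  apply: (nondecreasing_of_derive xc cDxc dDxc) => y; rewrite in_itv /= => /andP[xy yc].
  apply: dD0; last by rewrite gtM // ltW.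
  by rewrite in_itv /= (le_lt_trans ax xy) (lt_le_trans yc cb).
have Mc : M < D c := lt_le_trans Mx Dxc.
have /subspace_continuousP/(_ c cab) Dc := cD.
have : \forall y \near within `[a, b] (nbhs c), M < D y.
  exact: Dc (lt_nbhsr Mc).
rewrite near_withinE => /nbhs_ballP[d /= d0 dP].
have [y [/andP[xy yb] DyM] yd] := inf_adherent d0 hinf.
have cy : c <= y.
  by apply: ge_inf; [exact: hinf.2|split => //; rewrite xy].
have : M < D y.
  apply: dP; last by rewrite /= in_itv /= (le_trans ax xy).
  by rewrite /ball /= distrC ger0_norm ?subr_ge0 // ltrBlDl.
by rewrite ltNge DyM.
Qed.

Lemma eq_derive_eq F G dF a b : a <= b ->
  {within `[a, b], continuous F} -> {within `[a, b], continuous G} ->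
  (forall x, x \in `]a, b[ -> is_derive x 1 F (dF x)) ->
  (forall x, x \in `]a, b[ -> is_derive x 1 G (dF x)) ->
  F b = G b -> F a = G a.
Proof.
move=> ab cF cG dFE dGE FGb; apply/eqP; rewrite -subr_eq0; apply/eqP.
have dFG x : x \in `]a, b[ -> is_derive x 1 (F \- G) (cst 0 x).
  move=> xab; have := dFE _ xab; have := dGE _ xab => ? ?.
  by apply: is_derive_eq; rewrite subrr.
have cFG : {within `[a, b], continuous (F \- G)}.
  by move=> x; apply: cvgB; [exact: cF|exact: cG].
have [z zab] := MVT_segment ab dFG cFG.
by rewrite /= mul0r FGb subrr sub0r => h; apply/oppr_inj; rewrite oppr0.
Qed.

(** Mean value inequality for F minus a linear map. The case c = 0 gives Lipschitz bounds. The
    conclusion mentions no derivative, so it survives pointwise limits; [is_derive_of_lin_approx]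
    then recovers the derivative of the limit. *)
Lemma derive_lin_approx F dF a b c e x y :
  {within `[a, b], continuous F} ->
  (forall x, x \in `]a, b[ -> is_derive x 1 F (dF x)) ->
  (forall x, x \in `]a, b[ -> `|dF x - c| <= e) ->
  x \in `[a, b] -> y \in `[a, b] ->
  `|F y - F x - c * (y - x)| <= e * `|y - x|.
Proof.
move=> cF dFE dFe.
wlog xy : x y / x <= y.
  move=> wl xab yab; have [|/ltW] := leP x y; first by move/wl; exact.
  move=> /wl/(_ yab xab); rewrite (distrC x y) -[X in X <= _]normrN.
  by congr (`| _ | <= _); ring.
rewrite !in_itv /= => /andP[ax xb] /andP[ay yb].
move: xy; rewrite le_eqVlt => /predU1P[->|xy].
  by rewrite !subrr mulr0 subr0 normr0 mulr0.
have dFxy z : z \in `]x, y[ -> is_derive z 1 F (dF z).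
  rewrite in_itv /= => /andP[xz zy].
  by apply: dFE; rewrite in_itv /= (le_lt_trans ax xz) (lt_le_trans zy yb).
have cFxy : {within `[x, y], continuous F}.
  apply: continuous_subspaceW cF => z /=; rewrite !in_itv /= => /andP[xz zy].
  by rewrite (le_trans ax xz) (le_trans zy yb).
have [z zxy E] := MVT xy dFxy cFxy.
rewrite E -mulrBl normrM ler_wpM2r // dFe //.
by move: zxy; rewrite !in_itv /= => /andP[xz zy]; rewrite (le_lt_trans ax xz) (lt_le_trans zy yb).
Qed.

Lemma is_derive_of_lin_approx F x c :
  (forall e, 0 < e -> \forall y \near x, `|F y - F x - c * (y - x)| <= e * `|y - x|) ->
  is_derive x (1 : R) F c.
Proof.
move=> Fx.
have cF : (fun h => h^-1 *: ((F \o shift x) (h *: 1) - F x)) @ 0^' --> c.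
  apply/cvgrPdist_le => e e0.
  have /nbhs_ballP[d /= d0 dP] := Fx _ e0.
  apply/nbhs_ballP; exists d => // h /=.
  rewrite /ball /= sub0r normrN => hd h0.
  have := dP (h + x); rewrite /ball /= addrK opprD addrCA subrr addr0 normrN => /(_ hd).
  move=> Fh; rewrite distrC /shift /= [h *: _]mulr1.
  have -> : h^-1 *: (F (h + x) - F x) - c = h^-1 * (F (h + x) - F x - c * h).
    by rewrite mulrBr mulrCA mulVf // mulr1.
  by rewrite normrM normfV mulrC ler_pdivrMr ?normr_gt0.
apply: DeriveDef; first by apply/cvg_ex; exists c.
exact: cvg_lim cF.
Qed.

Lemma is_derive_lin F G (dF dG c x : R) :
  is_derive x (1 : R) F dF -> is_derive x (1 : R) G dG ->
  is_derive x (1 : R) (fun y => c * F y - G y) (c * dF - dG).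
Proof. by move=> dFx dGx; exact: (is_deriveB (is_deriveZ c dFx) dGx). Qed.

Lemma continuous_lin (A : set R) F G c :
  {within A, continuous F} -> {within A, continuous G} ->
  {within A, continuous (fun y => c * F y - G y)}.
Proof.
move=> cF cG x; apply: cvgB; last exact: cG.
by apply: cvgM; [exact: cvg_cst|exact: cF].
Qed.

Lemma antiderivative (phi : R -> R) a : continuous phi ->
  exists P : R -> R, forall x, a < x -> is_derive x 1 P (phi x).
Proof.
move=> cphi.
pose P x := (\int[lebesgue_measure]_(t in [set` `[a, x]]) (phi t))%R.
exists P => x ax.
have iphi : lebesgue_measure.-integrable `[a, x + 1] (EFin \o phi).
  apply: continuous_compact_integrable; first exact: segment_compact.
  exact: continuous_subspaceT.
have x1 : x < x + 1 by rewrite ltrDl.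
have [dP PE] := continuous_FTC1_closed x1 iphi ax (cphi x).
by apply: (DeriveDef dP); rewrite -derive1E; exact: PE.
Qed.
End Calculus.

(** * Delay equations *)

Section Delay.
Context {R : realType}.

Definition clamp (a b x : R) : R := Num.max a (Num.min x b).

Lemma clamp_ge (a b x : R) : a <= clamp a b x.
Proof. by rewrite le_max lexx. Qed.

Lemma clamp_le (a b x : R) : a <= b -> clamp a b x <= b.
Proof. by move=> ab; rewrite ge_max ab ge_min lexx orbT. Qed.

Lemma clamp_id (a b x : R) : a <= x <= b -> clamp a b x = x.
Proof. by case/andP=> ax xb; rewrite /clamp min_l // max_r. Qed.

Lemma continuous_clamp (a b : R) : continuous (clamp a b).
Proof.
move=> x; apply: (@continuous_max R _ (cst a) (Num.min^~ b)).
  exact: cst_continuous.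
apply: (@continuous_min R _ id (cst b)); first exact: cvg_id.
exact: cst_continuous.
Qed.

Lemma cvg_maxr T (F : set_system T) {FF : Filter F} (x y : T -> R) (a b : R) :
  x @ F --> a -> y @ F --> b -> (fun t => Num.max (x t) (y t)) @ F --> Num.max a b.
Proof.
move=> xa yb; apply: (@continuous2_cvg _ R R R F _ x y (fun u v : R => Num.max u v) a b _ xa yb).
by apply: (@continuous_max R (R * R)%type fst snd (a, b)); [exact: cvg_fst|exact: cvg_snd].
Qed.

(** Method of steps: on a strip of length [h] the right-hand side involves only values of [W]
    already constructed on its right, so each strip is solved by one integration. *)
Lemma delay_solution (G : R -> R -> R) (h u1 c0 A : R) : 0 < h ->
  (forall W : R -> R, continuous W -> continuous (fun u => G u (W (u + h)))) ->
  exists W : R -> R, [/\ continuous W, forall u, u1 <= u -> W u = c0 &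
    forall u, u1 - A < u < u1 -> is_derive u 1 W (G u (W (u + h)))].
Proof.
move=> h0 cG.
have solve n : exists W : R -> R, [/\ continuous W, forall u, u1 <= u -> W u = c0 &
    forall u, u1 - n%:R * h < u < u1 -> is_derive u 1 W (G u (W (u + h)))].
  elim: n => [|n [W [cW Wc dW]]].
    exists (cst c0); split => // [|u]; first exact: cst_continuous.
    by rewrite mul0r subr0 => /andP[/lt_trans h1 /h1]; rewrite ltxx.
  pose a := u1 - n.+1%:R * h.
  have au1 : a < u1 by rewrite gtrBl mulr_gt0.
  (* The base point [a - 1] makes [P] differentiable at [a] itself, hence continuous on the whole
     range of the clamp. *)
  have [P dP] := @antiderivative R (fun u => G u (W (u + h))) (a - 1) (cG _ cW).
  have aP x : a <= x -> is_derive x 1 P (G x (W (x + h))).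
    by move=> ax; apply: dP; rewrite (lt_le_trans _ ax) // gtrBl.
  pose W' u := c0 + P (clamp a u1 u) - P u1.
  have cW' : continuous W'.
    move=> u; apply: cvgB; last exact: cst_continuous.
    apply: cvgD; first exact: cst_continuous.
    apply: (@continuous_comp _ _ _ (clamp a u1) P); first exact: continuous_clamp.
    have [dPu _] := aP _ (clamp_ge a u1 u).
    exact/differentiable_continuous/derivable1_diffP.
  have W'c u : u1 <= u -> W' u = c0.
    by move=> u1u; rewrite /W' /clamp min_r // max_r ?addrK // ltW.
  have dW' u : a < u < u1 -> is_derive u 1 W' (G u (W (u + h))).
    move=> /andP[au uu1].
    have := aP _ (ltW au) => dPu.
    have : is_derive u 1 (cst c0 \+ P \- cst (P u1)) (G u (W (u + h))).
      by apply: is_derive_eq; rewrite add0r subr0.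
    apply: near_eq_is_derive.
    near=> x; rewrite /W' /= clamp_id //.
    by apply/andP; split; apply: ltW; near: x; [exact: lt_nbhsr|exact: lt_nbhsl].
  exists W'; split => // u /andP[au uu1].
  (* [W'] was built from the delayed values of the old [W]. It solves its own delay equation because
     both functions have the same derivative between [u + h] and [u1] and the same value at [u1]. *)
  suff -> : W' (u + h) = W (u + h) by apply: dW'; rewrite au.
  have [u1uh|uhu1] := leP u1 (u + h); first by rewrite W'c ?Wc.
  have anu : u1 - n%:R * h < u + h by move: au; rewrite mulrS; lra.
  have cT (F : R -> R) (B : set R) : continuous F -> {within B, continuous F}.
    exact: continuous_subspaceT.
  have d1 x : x \in `]u + h, u1[ -> is_derive x 1 W' (G x (W (x + h))).
    rewrite in_itv /= => /andP[uhx xu1]; apply: dW'.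
    by rewrite xu1 andbT (lt_trans _ uhx) // (lt_trans au) // ltrDl.
  have d2 x : x \in `]u + h, u1[ -> is_derive x 1 W (G x (W (x + h))).
    rewrite in_itv /= => /andP[uhx xu1]; apply: dW.
    by rewrite xu1 andbT (lt_trans anu).
  by apply: (eq_derive_eq (ltW uhu1) (cT _ _ cW') (cT _ _ cW) d1 d2); rewrite W'c ?Wc.
pose n := Num.truncn (`|A| / h).
have [W [cW Wc dW]] := solve n.+1.
exists W; split => // u /andP[Au uu1]; apply: dW; rewrite uu1 andbT.
apply: le_lt_trans Au; rewrite lerD2l lerN2 (le_trans (ler_norm A)) //.
by rewrite -ler_pdivrMr // ltW // truncnS_gt.
Unshelve. all: by end_near.
Qed.
End Delay.

(** * The singular equation V' = sigma - f H(u, V) *)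

Section SingularODE.
Context {R : realType}.

(* [H] stands for the reciprocal 1/g of the inverse flux, which behaves like 1/v
   near v = 0. *)
Record rate (H : R -> R -> R) (m M v0 : R) : Prop := Rate {
  rate_m_gt0 : 0 < m;
  rate_v0_gt0 : 0 < v0;
  rate_ge0 : forall u v : R, u \in `[0, 1] -> 0 < v -> 0 <= H u v;
  rate_noninc : forall u v w : R, u \in `[0, 1] -> 0 < v -> v <= w -> H u w <= H u v;
  rate_cvg : forall (T : Type) (F : set_system T), Filter F ->
    forall (x y : T -> R) (u v : R), u \in `[0, 1] -> 0 < v ->
    x @ F --> u -> y @ F --> v -> (\forall t \near F, x t \in `[0, 1]) ->
    H (x t) (y t) @[t --> F] --> H u v;
  rate_ge : forall u v : R, u \in `[0, 1] -> 0 < v -> v <= v0 -> m / v <= H u v;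
  rate_le : forall u v : R, u \in `[0, 1] -> 0 < v -> v <= v0 -> H u v <= M / v }.

Record reaction (f df : R -> R) (C : R) : Prop := Reaction {
  reaction_C_ge0 : 0 <= C;
  reaction_cont : {within `[0, 1], continuous f};
  reaction_derive : forall u : R, u \in `]0, 1[ -> is_derive u 1 f (df u);
  reaction_bound : forall u : R, u \in `]0, 1[ -> `|df u| <= C;
  reaction0 : f 0 = 0;
  reaction1 : f 1 = 0;
  reaction_gt0 : forall u : R, u \in `]0, 1[ -> 0 < f u }.

Lemma lipschitz_within (V : R -> R) (K a b : R) : 0 <= K ->
  (forall x y : R, x \in `[a, b] -> y \in `[a, b] -> `|V x - V y| <= K * `|x - y|) ->
  {within `[a, b], continuous V}.
Proof.
move=> K0 VK; apply/subspace_continuousP => x xab.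
apply/cvgrPdist_le => e e0; rewrite near_withinE.
have d0 : 0 < e / (K + 1) by rewrite divr_gt0 // ltr_wpDl.
apply/nbhs_ballP; exists (e / (K + 1)) => // y xy yab.
apply: le_trans (VK _ _ xab yab) _.
have K1 : 0 < K + 1 by rewrite ltr_wpDl.
apply: (@le_trans _ _ (K * (e / (K + 1)))); first by rewrite ler_wpM2l // ltW.
by rewrite mulrCA -[leRHS]mulr1 ler_wpM2l ?(ltW e0) // ler_pdivrMr // mul1r lerDl.
Qed.

Lemma cvg_of_cauchy_bound (w e : nat -> R) : e @ \oo --> (0 : R) ->
  (forall n k, (n <= k)%N -> `|w n - w k| <= e n) ->
  exists l, w @ \oo --> l /\ forall n, `|w n - l| <= e n.
Proof.
move=> e0 we.
have cw : cvgn w.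
  apply: R_complete; apply: cauchy_exP => d d0.
  have /cvgrPdist_lt/(_ _ d0)[N _ eN] := e0.
  exists (w N); exists N => // k /= Nk.
  rewrite /ball /= (le_lt_trans (we _ _ Nk)) // (le_lt_trans (ler_norm _)) //.
  by have := eN N (leqnn N); rewrite sub0r normrN.
exists (limn w); split => // n.
apply: (@cvgr_to_le _ \oo _ _ (fun k => `|w n - w k|)).
  by apply: cvg_norm; apply: cvgB; [exact: cvg_cst|exact: cw].
by exists n => // k; exact: we.
Qed.

Variables (H : R -> R -> R) (m M v0 : R) (f df : R -> R) (C sigma : R).
Hypotheses (Hrate : rate H m M v0) (Hf : reaction f df C) (sigma0 : 0 <= sigma).

Lemma rate_M_ge0 : 0 <= M.
Proof.
have v00 := rate_v0_gt0 Hrate; have m0 := rate_m_gt0 Hrate.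
have i0 : (0 : R) \in `[0, 1] by rewrite in_itv /= lexx ler01.
have := le_trans (rate_ge Hrate i0 v00 (lexx _)) (rate_le Hrate i0 v00 (lexx _)).
by rewrite ler_pM2r ?invr_gt0 //; apply: le_trans; exact: ltW.
Qed.

Lemma reaction_lipschitz (x y : R) : x \in `[0, 1] -> y \in `[0, 1] ->
  `|f x - f y| <= C * `|x - y|.
Proof.
move=> x01 y01; rewrite -[f x - f y]subr0 -[X in _ - X](mul0r (x - y)).
apply: (derive_lin_approx (reaction_cont Hf) (reaction_derive Hf)) => // u u01.
by rewrite subr0 (reaction_bound Hf).
Qed.

Lemma reaction_ge0 (x : R) : x \in `[0, 1] -> 0 <= f x.
Proof.
rewrite in_itv /= => /andP[x0 x1].
have [->|xn0] := eqVneq x 0; first by rewrite (reaction0 Hf).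
have [->|xn1] := eqVneq x 1; first by rewrite (reaction1 Hf).
by apply/ltW/(reaction_gt0 Hf); rewrite in_itv /= !lt_def xn0 x0 eq_sym xn1.
Qed.

Lemma reaction_le_dist1 (x : R) : x \in `[0, 1] -> f x <= C * (1 - x).
Proof.
move=> x01; have i1 : (1 : R) \in `[0, 1] by rewrite in_itv /= lexx ler01.
have := reaction_lipschitz x01 i1; rewrite (reaction1 Hf) subr0 distrC.
have /ger0_norm -> : 0 <= 1 - x by move: x01; rewrite in_itv /= subr_ge0 => /andP[].
exact: le_trans (ler_norm _).
Qed.

Lemma reaction_le_dist0 (x : R) : x \in `[0, 1] -> f x <= C * x.
Proof.
move=> x01; have i1 : (0 : R) \in `[0, 1] by rewrite in_itv /= lexx ler01.
have := reaction_lipschitz x01 i1; rewrite (reaction0 Hf) !subr0.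
have /ger0_norm -> : 0 <= x by move: x01; rewrite in_itv /= => /andP[].
exact: le_trans (ler_norm _).
Qed.

(** The second term gives f/L <= v0, so that the bounds m/v and M/v on H apply at v = f/L. The third
    gives C/L + sigma <= m L ([mL_ge]), which makes f/L a subsolution: its derivative is at least
    -C/L, while sigma - f H(u, f/L) <= sigma - m L. The constant K bounds the truncated right-hand
    side in absolute value. *)
Let L : R := 1 + C / v0 + (C + sigma) / m.
Let K : R := sigma + M * L.

Let C0 : 0 <= C. Proof. exact: reaction_C_ge0 Hf. Qed.
Let m0 : 0 < m. Proof. exact: rate_m_gt0 Hrate. Qed.
Let v00 : 0 < v0. Proof. exact: rate_v0_gt0 Hrate. Qed.

Let L1 : 1 <= L.
Proof. by rewrite /L -addrA lerDl addr_ge0 // divr_ge0 ?addr_ge0 // ltW. Qed.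

Let L0 : 0 < L. Proof. exact: lt_le_trans L1. Qed.

Let K0 : 0 <= K.
Proof. by rewrite /K addr_ge0 // mulr_ge0 ?rate_M_ge0 // ltW. Qed.

Let fL_le (u : R) : u \in `[0, 1] -> f u / L <= v0.
Proof.
move=> u01; rewrite ler_pdivrMr //.
have u1 : 1 - u <= 1 by move: u01; rewrite in_itv /= => /andP[u0 _]; rewrite lerBlDr lerDl.
apply: le_trans (reaction_le_dist1 u01) _.
apply: (@le_trans _ _ C); first by rewrite -[leRHS]mulr1 ler_wpM2l.
rewrite mulrC -ler_pdivrMr // /L.
by rewrite -addrA addrCA lerDl addr_ge0 // divr_ge0 ?addr_ge0 // ltW.
Qed.

Let mL_ge : C / L + sigma <= m * L.
Proof.
have : C + sigma <= m * L.
  rewrite mulrC -ler_pdivrMr // /L lerDr addr_ge0 // divr_ge0 // ltW //.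
apply: le_trans; rewrite lerD2r ler_pdivrMr // -[leLHS]mulr1 ler_wpM2l //.
Qed.

(* The delay and the distance to the end-points, where the equation is singular,
   are the same parameter [eta]. *)
Definition approx (L K eta : R) (W : R -> R) : Prop :=
  [/\ continuous W,
      forall x y : R, x \in `[0, 1] -> y \in `[0, 1] -> `|W x - W y| <= K * `|x - y|,
      W (1 - eta) = f (1 - eta) / L &
      forall u : R, u \in `]eta, 1 - eta[ ->
        is_derive u 1 W (sigma - f u * H u (Num.max (W (u + eta)) (f u / L)))].

(** Above f/L the factor f cancels the 1/v singularity of H. *)
Let fH_le (u v : R) : u \in `]0, 1[ -> f u / L <= v -> 0 <= f u * H u v <= M * L.
Proof.
move=> u01 uv; have fu := reaction_gt0 Hf u01.
have iu : u \in `[0, 1] by exact: subset_itv_oo_cc.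
have fL0 : 0 < f u / L by rewrite divr_gt0.
rewrite mulr_ge0 ?(ltW fu) ?(rate_ge0 Hrate) ?(lt_le_trans fL0) //=.
apply: (@le_trans _ _ (f u * (M / (f u / L)))).
  rewrite ler_wpM2l ?(ltW fu) // (le_trans (rate_noninc Hrate iu fL0 uv)) //.
  by rewrite (rate_le Hrate) // fL_le.
by rewrite le_eqVlt; apply/orP; left; apply/eqP; field; rewrite !gt_eqF.
Qed.

Lemma approx_exists (eta : R) : 0 < eta -> eta < 2^-1 -> exists W, approx L K eta W.
Proof.
move=> eta0 eta2.
have eta1 : eta <= 1 - eta by lra.
pose cl := clamp eta (1 - eta).
have cl01 u : cl u \in `]0, 1[.
  by rewrite in_itv /= (lt_le_trans eta0 (clamp_ge _ _ _)) (le_lt_trans (clamp_le _ eta1)) // gtrBl.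
have cl01' u : cl u \in `[0, 1] by exact: subset_itv_oo_cc.
have fc0 u : 0 < f (cl u) by exact: (reaction_gt0 Hf).
have cfc : continuous (f \o cl).
  move=> u; apply: continuous_comp; first exact: continuous_clamp.
  have [dfu _] := reaction_derive Hf (cl01 u).
  exact/differentiable_continuous/derivable1_diffP.
(* Freezing the coefficients outside [eta, 1 - eta] keeps f positive, so the right-hand side is
   continuous and bounded on the whole line. *)
pose G u v := sigma - f (cl u) * H (cl u) (Num.max v (f (cl u) / L)).
have Gb u v : `|G u v| <= K.
  have /andP[fH0 fH1] : 0 <= f (cl u) * H (cl u) (Num.max v (f (cl u) / L)) <= M * L.
    by rewrite fH_le // le_max lexx orbT.
  have := rate_M_ge0; have := L0 => L0' M0.
  have ML0 : 0 <= M * L by rewrite mulr_ge0 // ltW.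
  rewrite ler_norml /G /K.
  move: (f (cl u) * _) (M * L) fH0 fH1 ML0 sigma0 => p q *.
  by apply/andP; split; lra.
have cG (W : R -> R) : continuous W -> continuous (fun u => G u (W (u + eta))).
  move=> cW u; apply: cvgB; first exact: cvg_cst.
  apply: cvgM; first exact: cfc.
  apply: (rate_cvg Hrate) => //.
  - by rewrite lt_max divr_gt0 ?orbT.
  - exact: continuous_clamp.
  - apply: cvg_maxr.
      apply: (@continuous_comp _ _ _ (fun u => u + eta) W); last exact: cW.
      by apply: cvgD; [exact: cvg_id|exact: cvg_cst].
    by apply: cvgM; [exact: cfc|exact: cvg_cst].
  - exact: nearW.
(* Length 1 suffices: the solution reaches down to -eta, to the left of 0. *)
have [W [cW Wc dW]] := delay_solution (1 - eta) (f (1 - eta) / L) 1 eta0 cG.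
exists W.
have lipW x y : x \in `[0, 1 - eta] -> y \in `[0, 1 - eta] -> `|W x - W y| <= K * `|x - y|.
  move=> xI yI; rewrite -[W x - W y]subr0 -[X in _ - X](mul0r (x - y)).
  have dWI u : u \in `]0, 1 - eta[ -> is_derive u 1 W (G u (W (u + eta))).
    rewrite in_itv /= => /andP[u0 u1]; apply: dW; rewrite u1 andbT (lt_trans _ u0) //; lra.
  have cWI : {within `[0, 1 - eta], continuous W} by exact: continuous_subspaceT.
  by apply: (derive_lin_approx cWI dWI) => // u _; rewrite subr0.
split => //.
- move=> x y; rewrite !in_itv /= => /andP[x0 x1] /andP[y0 y1].
  have Wmin z : W z = W (Num.min z (1 - eta)).
    by have [//|/ltW zle] := leP z (1 - eta); rewrite Wc // Wc.
  rewrite (Wmin x) (Wmin y).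
  apply: (le_trans (lipW _ _ _ _)); rewrite ?in_itv /= ?le_min ?ge_min ?lexx ?orbT ?x0 ?y0; try lra.
  rewrite ler_wpM2l //.
  by have [?|?] := leP x (1 - eta); have [?|?] := leP y (1 - eta);
    rewrite ?subrr ?normr0 ?normr_ge0 //; rewrite ler_norml; apply/andP; split;
    have := ler_norm (x - y); have := ler_norm (y - x); rewrite (distrC y); lra.
- by rewrite Wc.
- move=> u; rewrite in_itv /= => /andP[u0 u1].
  have -> : sigma - f u * H u (Num.max (W (u + eta)) (f u / L)) = G u (W (u + eta)).
    by rewrite /G /cl clamp_id // (ltW u0) ltW.
  by apply: dW; rewrite u1 andbT; lra.
Qed.

(** * A priori estimates for the delayed equations, and passage to the limit *)

Let itv01 (eta u : R) : 0 < eta -> u \in `[eta, 1 - eta] -> u \in `[0, 1].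
Proof. by rewrite !in_itv /= => ? /andP[? ?]; apply/andP; split; lra. Qed.

Let itv01o (eta u : R) : 0 < eta -> u \in `]eta, 1 - eta[ -> u \in `]0, 1[.
Proof. by rewrite !in_itv /= => ? /andP[? ?]; apply/andP; split; lra. Qed.

(** The error [K * eta] is the price of the delay. Where f/L - W exceeds it, the Lipschitz bound
    forces W(u + eta) < f/L, so the equation is evaluated at f/L exactly; since f/L is a
    subsolution, f/L - W has nonnegative derivative there and [le_of_barrier] applies from the value
    0 at 1 - eta. *)
Lemma approx_ge (eta : R) W : 0 < eta -> approx L K eta W ->
  forall u : R, u \in `[eta, 1 - eta] -> f u / L - W u <= K * eta.
Proof.
move=> eta0 [cW lipW W1 dW] u uI; rewrite [f u / L]mulrC.
pose D x := L^-1 * f x - W x.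
have cD : {within `[eta, 1 - eta], continuous D}.
  apply: continuous_lin; last exact: continuous_subspaceT.
  by apply: continuous_subspaceW (reaction_cont Hf) => x; exact: itv01.
pose dD x := L^-1 * df x - (sigma - f x * H x (Num.max (W (x + eta)) (f x / L))).
have dDE x : x \in `]eta, 1 - eta[ -> is_derive x 1 D (dD x).
  move=> xI; apply: is_derive_lin; last exact: dW.
  exact: (reaction_derive Hf (itv01o eta0 xI)).
apply: (le_of_barrier cD dDE) uI.
  by rewrite /D W1 mulrC subrr mulr_ge0 // ltW.
move=> x xI DK; have x01 := itv01o eta0 xI.
have fx := reaction_gt0 Hf x01.
have x01' : x \in `[0, 1] by exact: subset_itv_oo_cc.
have xe01 : x + eta \in `[0, 1].
  by move: xI; rewrite !in_itv /= => /andP[? ?]; apply/andP; split; lra.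
have WxK : W (x + eta) <= W x + K * eta.
  rewrite -lerBlDl (le_trans (ler_norm _)) // (le_trans (lipW _ _ xe01 x01')) //.
  by rewrite addrAC subrr add0r gtr0_norm.
rewrite /dD; have -> : Num.max (W (x + eta)) (f x / L) = f x / L.
  by apply: max_r; move: DK; rewrite /D mulrC; lra.
have fL0 : 0 < f x / L by rewrite divr_gt0.
have Hlow : m * L <= f x * H x (f x / L).
  apply: (@le_trans _ _ (f x * (m / (f x / L)))); last first.
    by rewrite ler_wpM2l ?(ltW fx) // (rate_ge Hrate) // fL_le.
  by rewrite le_eqVlt; apply/orP; left; apply/eqP; field; rewrite !gt_eqF.
have dfC : - (C / L) <= L^-1 * df x.
  rewrite -mulrN1 [C / L]mulrC -mulrA ler_wpM2l ?invr_ge0 ?(ltW L0) // mulrN1.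
  by have := reaction_bound Hf x01; rewrite ler_norml => /andP[].
by have := mL_ge; lra.
Qed.

(** Each delay displaces a value by at most [K * e], so a gap above [2 * K * e] between [W1] and
    [W2] keeps the delayed values in the same order, and monotonicity of H makes the derivative of
    the difference nonnegative. The term [C * e] absorbs the end value f(1 - e1)/L. *)
Lemma approx_sub_le (e e1 e2 : R) W1 W2 : 0 < e1 -> e1 <= e -> 0 < e2 -> e2 <= e ->
  e < 2^-1 -> approx L K e1 W1 -> approx L K e2 W2 ->
  forall u : R, u \in `[e, 1 - e] -> W1 u - W2 u <= (2 * K + C) * e.
Proof.
move=> e10 e1e e20 e2e eh [cW1 lipW1 W11 dW1] [cW2 lipW2 W21 dW2] u uI.
have e0 : 0 < e := lt_le_trans e10 e1e.
have Ke i : i <= e -> K * i <= K * e by move=> ie; rewrite ler_wpM2l.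
have in1 i : 0 < i -> i <= e -> 1 - i \in `[0, 1].
  by move=> ? ?; rewrite in_itv /=; apply/andP; split; lra.
pose D x := 1 * W1 x - W2 x.
pose h i W x := f x * H x (Num.max (W (x + i)) (f x / L)).
pose dD x := 1 * (sigma - h e1 W1 x) - (sigma - h e2 W2 x).
have cD : {within `[e, 1 - e], continuous D}.
  by apply: continuous_lin; exact: continuous_subspaceT.
have sub i x : i <= e -> x \in `]e, 1 - e[ -> x \in `]i, 1 - i[.
  by move=> ?; rewrite !in_itv /= => /andP[? ?]; apply/andP; split; lra.
have dDE x : x \in `]e, 1 - e[ -> is_derive x 1 D (dD x).
  by move=> xI; apply: is_derive_lin; [apply: dW1|apply: dW2]; exact: sub.
rewrite -[W1 u]mul1r; apply: (le_of_barrier cD dDE) uI.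
  have a1 := le_trans (ler_norm _) (lipW1 _ _ (in1 _ e0 (lexx e)) (in1 _ e10 e1e)).
  have a2 := le_trans (ler_norm _) (lipW2 _ _ (in1 _ e20 e2e) (in1 _ e0 (lexx e))).
  have b1 : `|1 - e - (1 - e1)| <= e by rewrite ler_norml; apply/andP; split; lra.
  have b2 : `|1 - e2 - (1 - e)| <= e by rewrite ler_norml; apply/andP; split; lra.
  have c1 := le_trans a1 (Ke _ b1).
  have c2 := le_trans a2 (Ke _ b2).
  have f1 : f (1 - e1) / L <= C * e.
    rewrite ler_pdivrMr // (le_trans (reaction_le_dist1 (in1 _ e10 e1e))) //.
    rewrite opprB addrCA subrr addr0 (@le_trans _ _ (C * e)) ?ler_wpM2l //.
    by rewrite ler_peMr // mulr_ge0 // ltW.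
  have f2 : 0 <= f (1 - e2) / L.
    by rewrite divr_ge0 ?(ltW L0) // reaction_ge0 // in1.
  by move: c1 c2 f1 f2; rewrite W11 W21 /D; lra.
move=> x xI DM; have x01 := itv01o e0 xI.
have x01' : x \in `[0, 1] by exact: subset_itv_oo_cc.
have fx := reaction_gt0 Hf x01.
have xe01 i : 0 < i -> i <= e -> x + i \in `[0, 1].
  by move: xI; rewrite !in_itv /= => /andP[? ?] ? ?; apply/andP; split; lra.
have a1 := le_trans (ler_norm _) (lipW1 _ _ x01' (xe01 _ e10 e1e)).
have a2 := le_trans (ler_norm _) (lipW2 _ _ (xe01 _ e20 e2e) x01').
have b1 : `|x - (x + e1)| <= e by rewrite ler_norml; apply/andP; split; lra.
have b2 : `|x + e2 - x| <= e by rewrite ler_norml; apply/andP; split; lra.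
have c1 := le_trans a1 (Ke _ b1).
have c2 := le_trans a2 (Ke _ b2).
have Ce : 0 <= C * e by rewrite mulr_ge0 // ltW.
have WW : W2 (x + e2) <= W1 (x + e1) by move: DM; rewrite /D; lra.
suff : h e1 W1 x <= h e2 W2 x by rewrite /dD; lra.
rewrite /h ler_wpM2l ?(ltW fx) // (rate_noninc Hrate) //.
  by rewrite lt_max divr_gt0 ?orbT.
by rewrite ge_max !le_max WW lexx orbT.
Qed.

Lemma approx_dist_le (e1 e2 : R) W1 W2 : 0 < e2 -> e2 <= e1 -> e1 < 2^-1 ->
  approx L K e1 W1 -> approx L K e2 W2 ->
  forall u : R, u \in `[0, 1] -> `|W1 u - W2 u| <= (4 * K + C) * e1.
Proof.
move=> e20 e21 e1h a1 a2 u uI.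
have e10 := lt_le_trans e20 e21.
(* Moving [u] into [e1, 1 - e1] changes each of [W1] and [W2] by at most [K * e1], whence 4 K in
   place of 2 K. *)
pose u' := clamp e1 (1 - e1) u.
have u'I : u' \in `[e1, 1 - e1] by rewrite in_itv /= clamp_ge clamp_le //; lra.
have u'01 := itv01 e10 u'I.
have uu' : `|u - u'| <= e1.
  rewrite /u' /clamp; move: uI; rewrite in_itv /= => /andP[u0 u1].
  by have [?|?] := leP u (1 - e1); [have [?|?] := leP e1 u|have [?|?] := leP e1 (1 - e1)];
    rewrite ler_norml; apply/andP; split; lra.
have d12 := approx_sub_le e10 (lexx e1) e20 e21 e1h a1 a2 u'I.
have d21 := approx_sub_le e20 e21 e10 (lexx e1) e1h a2 a1 u'I.
have [_ l1 _ _] := a1; have [_ l2 _ _] := a2.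
have Ke : K * `|u - u'| <= K * e1 by rewrite ler_wpM2l.
have := le_trans (l1 _ _ uI u'01) Ke; have := le_trans (l2 _ _ uI u'01) Ke.
by rewrite !ler_norml => /andP[? ?] /andP[? ?]; apply/andP; split; lra.
Qed.

(** The solution is the uniform limit of the delayed ones. The bound f <= L V is part of the
    conclusion because it gives positivity of V and, later, boundedness of f H(u, V). *)
Lemma singular_solution_exists : exists (L : R) (V : R -> R),
  [/\ 0 < L, {within `[0, 1], continuous V}, V 1 = 0,
      forall u : R, u \in `]0, 1[ -> f u <= L * V u &
      forall u : R, u \in `]0, 1[ -> is_derive u 1 V (sigma - f u * H u (V u))].
Proof.
(* Starting at 1/3 keeps every delay below 1/2. *)
pose e n : R := n.+3%:R^-1.
have e0 n : 0 < e n by rewrite invr_gt0.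
have eh n : e n < 2^-1 by rewrite ltf_pV2 ?posrE // ltr_nat.
have ele n k : (n <= k)%N -> e k <= e n by move=> nk; rewrite lef_pV2 ?posrE // ler_nat.
have ecvg : e @ \oo --> (0 : R).
  apply/cvgrPdist_le => d d0; exists (Num.truncn d^-1) => // n /= nd.
  rewrite sub0r normrN gtr0_norm // invf_ple ?posrE //.
  apply: (le_trans (ltW (truncnS_gt _))); rewrite ler_nat.
  exact: leq_trans nd (leqW (leqW (leqnn n))).
have e_near (z : R) : 0 < z -> \forall n \near \oo, e n <= z.
  move=> z0; have /cvgrPdist_le/(_ _ z0) := ecvg.
  by apply: filterS => n; rewrite sub0r normrN gtr0_norm.
have /choice[W aW] : forall n, exists W, approx L K (e n) W.
  by move=> n; exact: approx_exists.
pose C3 := 4 * K + C.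
have C30 : 0 <= C3 by rewrite addr_ge0 // mulr_ge0.
have C3cvg : (fun n => C3 * e n) @ \oo --> (0 : R).
  by rewrite -(mulr0 C3); apply: cvgM; [exact: cvg_cst|exact: ecvg].
have /choice[V VP] : forall u : R, exists l : R, u \in `[0, 1] ->
    (fun n => W n u) @ \oo --> l /\ forall n, `|W n u - l| <= C3 * e n.
  move=> u; have [u01|nu] := boolP (u \in `[0, 1]); last by exists 0.
  have [|l lP] := @cvg_of_cauchy_bound (fun n => W n u) (fun n => C3 * e n) C3cvg; last by exists l.
  by move=> n k nk; apply: (approx_dist_le (e0 k) (ele _ _ nk) (eh n) (aW n) (aW k)).
have WcvgV (u : R) : u \in `[0, 1] -> (fun n => W n u) @ \oo --> V u by move=> /VP[].
have WV (u : R) n : u \in `[0, 1] -> `|W n u - V u| <= C3 * e n by move=> /VP[].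
have i1 : (1 : R) \in `[0, 1] by rewrite in_itv /= lexx ler01.
have lipV x y : x \in `[0, 1] -> y \in `[0, 1] -> `|V x - V y| <= K * `|x - y|.
  move=> x01 y01; apply: (@cvgr_to_le _ \oo _ _ (fun n => `|W n x - W n y|)).
    by apply: cvg_norm; apply: cvgB; exact: WcvgV.
  by apply: nearW => n; have [_ lipW _ _] := aW n; exact: lipW.
have cV := lipschitz_within K0 lipV.
have V1 : V 1 = 0.
  have : (fun n => W n 1) @ \oo --> (0 : R).
    apply: (@squeeze_cvgr _ _ _ _ (fun n => - ((K + C) * e n)) (fun n => (K + C) * e n)).
    - apply: nearW => n; have [_ lipW W1 _] := aW n.
      have en1 : 1 - e n \in `[0, 1].
        by have := e0 n; have := eh n; rewrite in_itv /= => ? ?; apply/andP; split; lra.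
      have := lipW _ _ i1 en1; rewrite W1 opprB addrCA subrr addr0 (gtr0_norm (e0 n)).
      have : f (1 - e n) / L <= C * e n.
        rewrite ler_pdivrMr // (le_trans (reaction_le_dist1 en1)) //.
        by rewrite opprB addrCA subrr addr0 ler_peMr // mulr_ge0 // ltW.
      have : 0 <= f (1 - e n) / L by rewrite divr_ge0 ?(ltW L0) // reaction_ge0.
      have := mulr_ge0 C0 (ltW (e0 n)).
      by rewrite ler_norml => ? ? ? /andP[? ?]; apply/andP; split; lra.
    - rewrite -(oppr0 R) -(mulr0 (K + C)); apply: cvgN.
      by apply: cvgM; [exact: cvg_cst|exact: ecvg].
    - by rewrite -(mulr0 (K + C)); apply: cvgM; [exact: cvg_cst|exact: ecvg].
  by move=> W10; apply: (cvg_unique _ (WcvgV _ i1) W10).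
have Vge (u : R) : u \in `]0, 1[ -> f u / L <= V u.
  move=> u01; have u01' : u \in `[0, 1] by exact: subset_itv_oo_cc.
  have [u0 u1] : 0 < u /\ 0 < 1 - u.
    by move: u01; rewrite in_itv /= subr_gt0 => /andP[].
  have : (fun n => W n u + K * e n) @ \oo --> V u.
    rewrite -[V u]addr0 -(mulr0 K); apply: cvgD; first exact: WcvgV.
    by apply: cvgM; [exact: cvg_cst|exact: ecvg].
  move=> /cvgr_to_ge; apply.
  near=> n; rewrite -lerBlDl; apply: approx_ge (aW n) _ _ => //.
  by rewrite in_itv /= [u <= _]lerBrDl -lerBrDr; apply/andP; split; near: n; exact: e_near.
exists L, V; split => //; first by move=> u u01; rewrite mulrC -ler_pdivrMr // Vge.
move=> u0 u01.
have u01' : u0 \in `[0, 1] by exact: subset_itv_oo_cc.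
have fu0 := reaction_gt0 Hf u01.
have [u00 u11] : 0 < u0 /\ u0 < 1 by move: u01; rewrite in_itv /= => /andP[].
have V0 : 0 < V u0 by rewrite (lt_le_trans _ (Vge _ u01)) // divr_gt0.
apply: is_derive_of_lin_approx => d d0.
set c := sigma - f u0 * H u0 (V u0).
have fcvg : f u @[u --> u0] --> f u0.
  have [dfu _] := reaction_derive Hf u01.
  exact/differentiable_continuous/derivable1_diffP.
(* The right-hand sides must converge jointly in (u, n): the derivatives of all late [W n] have to
   be close to [c] on one common neighbourhood of [u0]. *)
pose FF := filter_prod (nbhs u0) (nbhs (\oo : set_system nat)).
have near01 : \forall p \near FF, p.1 \in `[0, 1] /\ p.1 + e p.2 \in `[0, 1].
  have u02 : u0 < (1 + u0) / 2 by lra.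
  have e2 : 0 < (1 - u0) / 2 by lra.
  exists ([set u | 0 < u] `&` [set u | u < (1 + u0) / 2], [set n | e n <= (1 - u0) / 2]) => /=.
    split; first by apply: filterI; [exact: lt_nbhsr|exact: lt_nbhsl].
    exact: e_near.
  move=> -[u n] [/= [u_gt0 u2] en]; have := e0 n => en0.
  by split; rewrite in_itv /=; apply/andP; split; lra.
have ecvg2 : e p.2 @[p --> FF] --> (0 : R) by apply: cvg_comp ecvg; exact: cvg_snd.
have idcvg : p.1 @[p --> FF] --> u0 by exact: cvg_fst.
have Gcvg : sigma - f p.1 * H p.1 (Num.max (W p.2 (p.1 + e p.2)) (f p.1 / L)) @[p --> FF] --> c.
  apply: cvgB; first exact: cvg_cst.
  have f1 : f p.1 @[p --> FF] --> f u0 by apply: cvg_comp fcvg; exact: cvg_fst.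
  apply: cvgM => //; apply: (rate_cvg Hrate) => //.
  (* The truncation disappears in the limit, since V is at least f/L. The delayed values are
     squeezed by the Lipschitz bound on [V] and the uniform distance from [W n] to [V]. *)
  - rewrite -[V u0](@max_l _ _ _ (f u0 / L)) ?Vge //; apply: cvg_maxr; last first.
      by apply: cvgM => //; exact: cvg_cst.
    pose r p := K * `|u0 - (p.1 + e p.2)| + C3 * e p.2.
    have rcvg : r @ FF --> (0 : R).
      rewrite -[X in _ --> X](_ : K * `|u0 - (u0 + 0)| + C3 * 0 = 0); last first.
        by rewrite addr0 subrr normr0 !mulr0 addr0.
      apply: cvgD; apply: cvgM; [exact: cvg_cst| |exact: cvg_cst|exact: ecvg2].
      by apply: cvg_norm; apply: cvgB; [exact: cvg_cst|exact: cvgD].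
    apply: (@squeeze_cvgr _ _ _ _ (fun p => V u0 - r p) (fun p => V u0 + r p)).
    + apply: filterS near01 => p [_ p01].
      have := le_trans (ler_distD (V (p.1 + e p.2)) (V u0) (W p.2 (p.1 + e p.2))) _.
      move=> /(_ (r p)); rewrite -ler_distlC; apply.
      by rewrite lerD ?lipV // distrC WV.
    + by rewrite -[X in _ --> X]subr0; apply: cvgB; [exact: cvg_cst|exact: rcvg].
    + by rewrite -[X in _ --> X]addr0; apply: cvgD; [exact: cvg_cst|exact: rcvg].
  - by apply: filterS near01 => p [].
have /cvgrPdist_le/(_ _ d0)[[A B] /= [nA nB] AB] := Gcvg.
have /nbhs_ballP[r0 /= r00 rA] := nA.
pose r := Num.min (r0 / 2) (Num.min (u0 / 2) ((1 - u0) / 2)).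
have r_gt0 : 0 < r by rewrite !lt_min !divr_gt0 ?subr_gt0.
have rr0 : r <= r0 / 2 by rewrite ge_min lexx.
have ru0 : r <= u0 / 2 by rewrite !ge_min lexx !orbT.
have ru1 : r <= (1 - u0) / 2 by rewrite !ge_min lexx !orbT.
apply/nbhs_ballP; exists r => // y; rewrite /ball /= ltr_norml => /andP[y1 y2].
have inI z : u0 - r <= z <= u0 + r -> z \in `[0, 1].
  by move=> /andP[? ?]; rewrite in_itv /=; apply/andP; split; lra.
have y01 : y \in `[0, 1] by apply: inI; apply/andP; split; lra.
(* The linear approximation holds for [W n] with the same [d] for all late n, and passes to the
   limit with [y] fixed. *)
apply: (@cvgr_to_le _ \oo _ _ (fun n => `|W n y - W n u0 - c * (y - u0)|)).
  by apply: cvg_norm; apply: cvgB; [apply: cvgB; exact: WcvgV|exact: cvg_cst].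
have nearB : \forall n \near \oo, e n <= u0 / 2 /\ e n <= (1 - u0) / 2.
  by apply: filterI; apply: e_near; lra.
apply: filterS2 nB nearB => n Bn [en1 en2].
have [cW lipW W1 dW] := aW n.
have cWI : {within `[u0 - r, u0 + r], continuous (W n)} by exact: continuous_subspaceT.
have dWI z : z \in `]u0 - r, u0 + r[ ->
    is_derive z 1 (W n) (sigma - f z * H z (Num.max (W n (z + e n)) (f z / L))).
  rewrite in_itv /= => /andP[z1 z2]; apply: dW.
  by rewrite in_itv /=; apply/andP; split; lra.
apply: (derive_lin_approx cWI dWI).
- move=> z; rewrite in_itv /= => /andP[z1 z2]; rewrite distrC.
  apply: (AB (z, n)); split => //=; apply: rA.
  by rewrite /ball /= ltr_norml; apply/andP; split; lra.
- by rewrite in_itv /=; apply/andP; split; lra.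
- by rewrite in_itv /=; apply/andP; split; lra.
Unshelve. all: by end_near.
Qed.

End SingularODE.

(** * Comparison, and the rate 1/g of a flux *)

Section Comparison.
Context {R : realType}.
Variables (H : R -> R -> R) (m M v0 : R) (f df : R -> R) (C sigma : R).
Hypotheses (Hrate : rate H m M v0) (Hf : reaction f df C).

(** Where V > W > 0, monotonicity of H makes V - W nondecreasing, so a positive gap could not close
    before u = 1. *)
Lemma le_supersolution (V W dW : R -> R) :
  {within `[0, 1], continuous V} ->
  (forall u : R, u \in `]0, 1[ -> is_derive u 1 V (sigma - f u * H u (V u))) ->
  {within `[0, 1], continuous W} ->
  (forall u : R, u \in `]0, 1[ -> is_derive u 1 W (dW u)) ->
  (forall u : R, u \in `]0, 1[ -> 0 < W u) ->
  (forall u : R, u \in `]0, 1[ -> dW u <= sigma - f u * H u (W u)) ->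
  V 1 <= W 1 ->
  forall u : R, u \in `[0, 1] -> V u <= W u.
Proof.
move=> cV dV cW dWE W0 dWle VW1 u uI.
pose D x := 1 * V x - W x.
pose dD x := 1 * (sigma - f x * H x (V x)) - dW x.
have dDE (x : R) : x \in `]0, 1[ -> is_derive x 1 D (dD x).
  by move=> xI; apply: is_derive_lin; [exact: dV|exact: dWE].
rewrite -subr_le0 -[V u]mul1r.
apply: (le_of_barrier (continuous_lin (c := 1) cV cW) dDE) uI.
  by rewrite mul1r subr_le0.
move=> x xI; rewrite mul1r subr_gt0 /dD mul1r => WV.
have xI' : x \in `[0, 1] by exact: subset_itv_oo_cc.
have : f x * H x (V x) <= f x * H x (W x).
  by rewrite ler_wpM2l ?(ltW (reaction_gt0 Hf xI)) // (rate_noninc Hrate) ?W0 // ltW.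
by have := dWle _ xI; lra.
Qed.

End Comparison.

(** * The extended function 1/g of a flux: monotonicity, continuity, behaviour near v = 0 *)

Section FluxRate.
Context {R : realType}.

(** These properties persist when eps s is added to the flux. Continuity in u is stated along
    arbitrary filters because [rate_cvg] is applied to a product filter in (u, n). *)
Record flux (omega : R -> \bar R) (b : R -> R -> R) (m M s0 : R) : Prop := Flux {
  flux_m_gt0 : 0 < m;
  flux_s0_gt0 : 0 < s0;
  flux_incr : forall u s t : R, Omega omega (u, s) -> Omega omega (u, t) ->
    s < t -> b u s < b u t;
  flux0 : forall u : R, u \in `[0, 1] -> b u 0 = 0;
  flux_cont : forall u s : R, Omega omega (u, s) -> {for s, continuous (b u)};
  flux_cvg : forall (T : Type) (F : set_system T), Filter F ->
    forall (x : T -> R) (u s : R), Omega omega (u, s) -> x @ F --> u ->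
    (\forall t \near F, x t \in `[0, 1]) ->
    b (x t) s @[t --> F] --> b u s /\ \forall t \near F, Omega omega (x t, s);
  flux_small : forall u s : R, u \in `[0, 1] -> 0 <= s -> s <= s0 ->
    [/\ Omega omega (u, s), m * s <= b u s & b u s <= M * s] }.

Lemma Omega_between (omega : R -> \bar R) (u r s t : R) :
  Omega omega (u, r) -> Omega omega (u, t) -> r <= s -> s <= t -> Omega omega (u, s).
Proof.
rewrite /Omega /= => -[uI /andP[r1 _]] [_ /andP[_ t2]] rs st; split => //.
by rewrite (lt_le_trans r1) ?lee_fin // (le_lt_trans _ t2) ?lee_fin.
Qed.

Lemma Omega_open_right (omega : R -> \bar R) (u s : R) :
  Omega omega (u, s) -> exists t, s < t /\ Omega omega (u, t).
Proof.
rewrite /Omega /= => -[uI /andP[]].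
case: (omega u) => [r| |] /= h1 h2; last by rewrite ltNge leNye in h2.
  move: h1 h2; rewrite !lte_fin => h1 h2; exists ((s + r) / 2).
  by rewrite !lte_fin; split; [lra|split => //; apply/andP; split; lra].
by exists (s + 1); rewrite ltrDl ltNyr ltry.
Qed.

Variables (omega : R -> \bar R) (b : R -> R -> R) (m M s0 : R).
Hypothesis bflux : flux omega b m M s0.

Lemma flux_le (u s t : R) : Omega omega (u, s) -> Omega omega (u, t) ->
  s <= t -> b u s <= b u t.
Proof.
move=> us ut; rewrite le_eqVlt => /predU1P[->//|st].
exact/ltW/(flux_incr bflux).
Qed.

Lemma Omega0 (u : R) : u \in `[0, 1] -> Omega omega (u, 0).
Proof. by move=> uI; have [] := flux_small bflux uI (lexx 0) (ltW (flux_s0_gt0 bflux)). Qed.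

(** A monotone limit is a supremum; this form no longer distinguishes finite from infinite
    [omega u]. *)
Lemma a_plus_sup (u : R) : u \in `[0, 1] ->
  a_plus omega b u = ereal_sup [set (b u s)%:E | s in [set s | Omega omega (u, s)]].
Proof.
move=> uI; set l := ereal_sup _; rewrite /a_plus.
have ub s : Omega omega (u, s) -> ((b u s)%:E <= l)%E.
  by move=> us; apply: ereal_sup_ubound; exists s.
have O0 := Omega0 uI.
suff cvgF (F : set_system R) : ProperFilter F ->
    (\forall s \near F, Omega omega (u, s)) ->
    (forall s, Omega omega (u, s) -> \forall t \near F, s <= t) ->
    (b u s)%:E @[s --> F] --> l.
  have [_ /= /andP[_]] := O0.
  case ou : (omega u) => [r| |] /= r0; last by rewrite ltNge leNye in r0.
    rewrite lte_fin in r0; apply: cvg_lim => //; apply: cvgF.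
      near=> s; split => //=; rewrite ou !lte_fin; apply/andP; split; near: s.
        by apply: nbhs_left_gt; lra.
      exact: nbhs_left_lt.
    move=> s [_ /=]; rewrite ou !lte_fin => /andP[_ sr].
    by near=> t; apply: ltW; near: t; exact: nbhs_left_gt.
  apply: cvg_lim => //; apply: cvgF.
    by apply: nearW => s; split => //=; rewrite ou ltNyr ltry.
  by move=> s _; apply: nbhs_pinfty_ge; rewrite num_real.
move=> PF FO Fge.
have Fb s : Omega omega (u, s) -> \forall t \near F, b u s <= b u t.
  by move=> us; near=> t; apply: flux_le => //; near: t => //; exact: Fge.
case lE : l => [r| |].
- apply: cvg_EFin; first exact: nearW.
  apply/cvgrPdist_le => e e0.
  have : ((r - e)%:E < l)%E by rewrite lE lte_fin gtrBl.
  move=> /ereal_sup_gt[_ [s us <-] /= ls].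
  near=> t; have : b u s <= b u t by near: t; exact: Fb.
  have : ((b u t)%:E <= l)%E by apply: ub; near: t.
  by move: ls; rewrite lE lee_fin lte_fin ler_norml => ? ? ?; apply/andP; split; lra.
- apply/cvgeyPge => A.
  have : (A%:E < l)%E by rewrite lE ltry.
  move=> /ereal_sup_gt[_ [s us <-] /= ls].
  near=> t; rewrite lee_fin; apply: (le_trans (y := b u s)).
    by rewrite lte_fin in ls; exact: ltW.
  by near: t; exact: Fb.
- by have := ub _ O0; rewrite lE leeNy_eq.
Unshelve. all: by end_near.
Qed.

Lemma flux_lt_a_plus (u s : R) : Omega omega (u, s) -> ((b u s)%:E < a_plus omega b u)%E.
Proof.
move=> us; have [t [st ut]] := Omega_open_right us; have [uI _] := us.
rewrite a_plus_sup //; apply: (@lt_le_trans _ _ (b u t)%:E).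
  by rewrite lte_fin (flux_incr bflux).
by apply: ereal_sup_ubound; exists t.
Qed.

Lemma g_spec (u v : R) : u \in `[0, 1] -> 0 < v -> (v%:E < a_plus omega b u)%E ->
  [/\ Omega omega (u, g omega b u v), b u (g omega b u v) = v & 0 < g omega b u v].
Proof.
move=> uI v0; rewrite a_plus_sup // => /ereal_sup_gt[_ [s us <-]]; rewrite lte_fin => vs.
have O0 := Omega0 uI; have b0 := flux0 bflux uI.
have s_ge0 : 0 <= s.
  rewrite leNgt; apply/negP => s0'; have := flux_incr bflux us O0 s0'.
  by rewrite b0; lra.
have cb : {within `[0, s], continuous (b u)}.
  apply: continuous_in_subspaceT => t; rewrite inE /= in_itv /= => /andP[t0 ts].
  exact: (flux_cont bflux (Omega_between O0 us t0 ts)).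
have [t] : exists2 t, t \in `[0, s] & b u t = v.
  apply: IVT => //; rewrite b0 (min_idPl _) ?(max_idPr _) ?(ltW v0) ?(ltW vs) //;
  by rewrite (ltW (lt_trans v0 vs)).
rewrite in_itv /= => /andP[t0 ts] btv.
have [ug bg] : Omega omega (u, g omega b u v) /\ b u (g omega b u v) = v.
  apply: (@getPex _ [set s | Omega omega (u, s) /\ b u s = v]); exists t.
  by split => //; exact: Omega_between O0 us t0 ts.
split => //; rewrite ltNge; apply/negP => g0.
by have := flux_le ug O0 g0; rewrite b0 bg; lra.
Qed.

Lemma calH_ge0 (u v : R) : u \in `[0, 1] -> 0 < v -> 0 <= calH omega b u v.
Proof.
move=> uI v0; rewrite /calH; case: ifPn => // va.
by have [_ _ g0] := g_spec uI v0 va; rewrite invr_ge0 ltW.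
Qed.

Hypothesis b_plus_infty : forall u : R, u \in `[0, 1] -> (omega u < +oo)%E ->
  a_plus omega b u = +oo%E.

(* Every property of [calH] is derived from this characterization, which covers
   both cases of its definition. *)
Lemma calH_ltP (u v s : R) : u \in `[0, 1] -> 0 < v -> 0 < s ->
  calH omega b u v < s^-1 <-> Omega omega (u, s) /\ b u s < v.
Proof.
move=> uI v0 s_gt0; have O0 := Omega0 uI; rewrite /calH; case: ifPn => va.
  have [ug bg g0] := g_spec uI v0 va; rewrite ltf_pV2 ?posrE //; split.
    move=> sg; have us := Omega_between O0 ug (ltW s_gt0) (ltW sg).
    by split => //; rewrite -[ltRHS]bg (flux_incr bflux).
  move=> [us bv]; rewrite ltNge; apply/negP => gs.
  by have := flux_le ug us gs; rewrite bg; lra.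
rewrite invr_gt0 s_gt0; split => // _.
have us : Omega omega (u, s).
  split => //=; have [ou|] := eqVneq (omega u) +oo%E; first by rewrite ou ltNyr ltry.
  rewrite -ltey => /(b_plus_infty uI) aE.
  by move: va; rewrite aE ltry.
split => //; rewrite -lte_fin; apply: lt_le_trans (flux_lt_a_plus us) _.
by rewrite leNgt.
Qed.

Lemma calH_gt (u v s : R) : u \in `[0, 1] -> 0 < v -> 0 < s ->
  s^-1 < calH omega b u v ->
  exists t, [/\ 0 < t, t < s, Omega omega (u, t) & v < b u t].
Proof.
move=> uI v0 s_gt0; have := s_gt0; rewrite -invr_gt0 => si; rewrite /calH.
case: ifPn => [va|_]; last by move/(lt_trans si); rewrite ltxx.
have [ug bg g0] := g_spec uI v0 va; rewrite ltf_pV2 ?posrE // => gs.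
have [t [gt ut]] := Omega_open_right ug.
pose t' := Num.min t ((g omega b u v + s) / 2).
have gt' : g omega b u v < t' by rewrite lt_min gt /=; lra.
have ut' : Omega omega (u, t') by apply: Omega_between ug ut (ltW gt') _; rewrite ge_min lexx.
exists t'; split => //; first exact: lt_trans gt'.
  by rewrite gt_min; apply/orP; right; lra.
by rewrite -[ltLHS]bg (flux_incr bflux).
Qed.

(** Strict bounds on [calH] are strict inequalities between [v] and the flux at one fixed [s], and
    these are stable under small changes of (u, v). The argument is the same below, at and above v =
    a_+(u). *)
Lemma calH_cvg (T : Type) (F : set_system T) {FF : Filter F} (x y : T -> R) (u v : R) :
  u \in `[0, 1] -> 0 < v -> x @ F --> u -> y @ F --> v ->
  (\forall t \near F, x t \in `[0, 1]) ->
  calH omega b (x t) (y t) @[t --> F] --> calH omega b u v.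
Proof.
move=> uI v0 xu yv xI; apply/cvgrPdist_le => e e0.
set c := calH omega b u v; have c0 : 0 <= c by exact: calH_ge0.
have y0 : \forall t \near F, 0 < y t by exact: (cvgr_gt v).
have up : \forall t \near F, calH omega b (x t) (y t) < c + e.
  have ce0 : 0 < c + e by rewrite ltr_wpDl.
  have /(calH_ltP uI v0)[] : c < (c + e)^-1^-1 by rewrite invrK ltrDl.
    by rewrite invr_gt0.
  set s := (c + e)^-1 => us bv.
  have [bx Ox] := flux_cvg bflux FF us xu xI.
  have bm : b u s < (b u s + v) / 2 by lra.
  have mv : (b u s + v) / 2 < v by lra.
  near=> t; rewrite -[c + e]invrK; apply/calH_ltP; [by near: t|by near: t|by rewrite invr_gt0|].
  split; first by near: t.
  apply: (@lt_trans _ _ ((b u s + v) / 2)); near: t.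
    exact: (cvgr_lt _ bx).
  exact: (cvgr_gt _ yv).
have low : \forall t \near F, c - e <= calH omega b (x t) (y t).
  have [ce|ce] := leP (c - e) 0.
    by near=> t; apply: (le_trans ce); apply: calH_ge0; near: t.
  have s_gt0 : 0 < (c - e)^-1 by rewrite invr_gt0.
  have := @calH_gt u v (c - e)^-1 uI v0 s_gt0.
  rewrite invrK gtrBl => /(_ e0)[s [s0' sc us vb]].
  have [bx Ox] := flux_cvg bflux FF us xu xI.
  have bm : (b u s + v) / 2 < b u s by lra.
  have mv : v < (b u s + v) / 2 by lra.
  near=> t; apply: (@le_trans _ _ s^-1); first by rewrite -[c - e]invrK lef_pV2 ?posrE // ltW.
  rewrite leNgt; apply/negP => /calH_ltP[||//|_]; [by near: t|by near: t|].
  apply/negP; rewrite -leNgt; apply/ltW.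
  apply: (@lt_trans _ _ ((b u s + v) / 2)); near: t.
    exact: (cvgr_lt _ yv).
  exact: (cvgr_gt _ bx).
near=> t.
have : calH omega b (x t) (y t) < c + e by near: t.
have : c - e <= calH omega b (x t) (y t) by near: t.
by rewrite ler_norml => ? ?; apply/andP; split; lra.
Unshelve. all: by end_near.
Qed.

(** The bounds m s <= b <= M s near s = 0 invert to m/v <= 1/g <= M/v. For v <= m s0 both v/m and
    v/M are at most s0, so [flux_small] applies at the points involved. *)
Lemma flux_rate : rate (calH omega b) m M (m * s0).
Proof.
have m_gt0 := flux_m_gt0 bflux; have s0_gt0 := flux_s0_gt0 bflux.
have mM : m <= M.
  have i0 : (0 : R) \in `[0, 1] by rewrite in_itv /= lexx ler01.
  have [_ l1 l2] := flux_small bflux i0 (ltW s0_gt0) (lexx s0).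
  by rewrite -(ler_pM2r s0_gt0) (le_trans l1).
have M_gt0 : 0 < M := lt_le_trans m_gt0 mM.
split => //.
- exact: mulr_gt0.
- exact: calH_ge0.
- move=> u v w uI v0 vw; have w0 := lt_le_trans v0 vw.
  rewrite leNgt; apply/negP => lt; have Hw := le_lt_trans (calH_ge0 uI v0) lt.
  move: lt; rewrite -[ltRHS]invrK => /(calH_ltP uI v0 _)[]; first by rewrite invr_gt0.
  move=> us bv.
  have : calH omega b u w < (calH omega b u w)^-1^-1.
    by apply/calH_ltP => //; [rewrite invr_gt0|split => //; exact: lt_le_trans vw].
  by rewrite invrK ltxx.
- by move=> T F FF x y u v; exact: calH_cvg.
- move=> u v uI v0 vs; rewrite leNgt; apply/negP; rewrite -[m / v]invf_div.
  move=> /(calH_ltP uI v0 (divr_gt0 v0 m_gt0))[us].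
  have vm0 : 0 <= v / m by rewrite divr_ge0 // ltW.
  have vms : v / m <= s0 by rewrite ler_pdivrMr // mulrC.
  have [_ l1 _] := flux_small bflux uI vm0 vms.
  by move: l1; rewrite mulrCA mulfV ?gt_eqF // mulr1; lra.
- move=> u v uI v0 vs; rewrite leNgt; apply/negP; rewrite -[M / v]invf_div.
  move=> /(calH_gt uI v0 (divr_gt0 v0 M_gt0))[t [t0 tv ut vb]].
  have ts : t <= s0.
    rewrite (le_trans (ltW tv)) // ler_pdivrMr // (le_trans vs) //.
    by rewrite mulrC ler_wpM2l // ltW.
  have [_ _ l2] := flux_small bflux uI (ltW t0) ts.
  by move: tv; rewrite ltr_pdivlMr // mulrC; lra.
Qed.

End FluxRate.

(** * Consequences of the C1 hypotheses *)

Section Regularity.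
Context {R : realType}.

Lemma is_derive_within_near (A : set R) (f : R -> R) (x l : R) : is_derive_within A f x l ->
  forall e, 0 < e -> \forall y \near x, A y -> `|f y - f x - l * (y - x)| <= e * `|y - x|.
Proof.
move=> fx e e0; have /cvgrPdist_le/(_ _ e0) := fx.
rewrite near_withinE => /nbhs_ballP[d /= d0 dP].
apply/nbhs_ballP; exists d => // y yd Ay.
have [->|yx] := eqVneq y x; first by rewrite !subrr mulr0 subr0 normr0 mulr0.
have yx0 : y - x != 0 by rewrite subr_eq0.
have -> : f y - f x - l * (y - x) = - (l - (f y - f x) / (y - x)) * (y - x) by field.
by rewrite normrM normrN ler_wpM2r // (dP y yd yx Ay).
Qed.

Lemma reaction_of_C1 (f : R -> R) : C1_on `[0, 1] f -> f 0 = 0 -> f 1 = 0 ->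
  (forall u, u \in `]0, 1[ -> 0 < f u) -> exists df C, reaction f df C.
Proof.
move=> [df [cdf dfE]] f0 f1 fgt0; exists df.
have cn : {within `[0, 1], continuous (fun x => `|df x|)}.
  by move=> x; apply: cvg_norm; exact: cdf.
have [c _ cmax] := EVT_max ler01 cn.
exists `|df c|; split => //.
- apply/subspace_continuousP => x xI; apply/cvgrPdist_le => e e0.
  have K0 : 0 < 1 + `|df x| by rewrite ltr_pwDl.
  have lin := is_derive_within_near (dfE _ xI) ltr01.
  rewrite near_withinE; near=> y => yI.
  have : `|f y - f x - df x * (y - x)| <= 1 * `|y - x| by move: yI; near: y.
  have ye : `|y - x| <= e / (1 + `|df x|).
    near: y; apply/nbhs_ballP; exists (e / (1 + `|df x|)); first exact: divr_gt0.
    by move=> y; rewrite /ball /= distrC => /ltW.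
  move: ye; rewrite ler_pdivlMr // => ye.
  have tri := ler_normD (f y - f x - df x * (y - x)) (df x * (y - x)).
  move=> h; move: tri; rewrite subrK normrM => tri; rewrite distrC.
  by apply: le_trans tri _; move: ye h; rewrite mulrDr mulr1 mul1r mulrC; lra.
- move=> u uI; apply: is_derive_of_lin_approx => e e0.
  have uI' : u \in `[0, 1] by exact: subset_itv_oo_cc.
  have lin := is_derive_within_near (dfE _ uI') e0.
  have uN : \forall y \near u, y \in `]0, 1[ by exact: near_in_itvoo.
  by apply: filterS2 lin uN => y h yI; apply: h; exact: subset_itv_oo_cc.
- by move=> u uI; apply: cmax; exact: subset_itv_oo_cc.
Unshelve. all: by end_near.
Qed.

(** By continuity and positivity of da/ds at (u, 0), together with compactness of [0, 1], one [d]
    bounds da/ds between d and 1/d for 0 <= s <= d, uniformly in u. It serves as m, as 1/M and as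
    s0. *)
Lemma flux_of_C1 (omega : R -> \bar R) (a : R -> R -> R) :
  (forall u : R, u \in `[0, 1] -> (0 < omega u)%E) ->
  lower_semicontinuous (omega : subspace `[0, 1] -> \bar R) ->
  {within Omega omega, continuous (fun p : R * R => a p.1 p.2)} ->
  (forall u s : R, Omega omega (u, s) -> a u (- s) = - a u s) ->
  (forall u s t : R, Omega omega (u, s) -> Omega omega (u, t) -> s < t -> a u s < a u t) ->
  C1_Omega omega a ->
  (forall u s : R, Omega omega (u, s) -> 0 < derive1 (a u) s) ->
  exists m M s0 : R, flux omega a m M s0 /\
    forall u s t : R, u \in `[0, 1] -> 0 <= s -> s <= t -> t <= s0 ->
      m * (t - s) <= a u t - a u s.
Proof.
move=> omega_gt0 lsc cont odd incr [_ [dera cder]] das.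
have O0 (u : R) : u \in `[0, 1] -> Omega omega (u, 0).
  by move=> uI; split => //=; rewrite oppe_lt0 omega_gt0.
have lscN (u0 s : R) : u0 \in `[0, 1] -> (s%:E < omega u0)%E ->
    \forall u \near u0, u \in `[0, 1] -> (s%:E < omega u)%E.
  move=> uI su; have [V nV VP] := lsc u0 s su.
  have : within `[0, 1] (nbhs u0) V by rewrite nbhs_subspace_in.
  by rewrite /within /=; apply: filterS => u h uI'; exact: VP (h uI').
pose P (d u : R) := u \in `[0, 1] -> forall s : R, 0 <= s -> s <= d ->
  [/\ Omega omega (u, s), d <= derive1 (a u) s & derive1 (a u) s <= d^-1].
have : \forall d \near (0 : R)^'+, `[0, 1] `<=` P d.
  apply: (compact_near_coveringP _).1 (@segment_compact R 0 1) _ _ _ _ _ => u0 uI.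
  have das0 := das _ _ (O0 _ uI); set c := derive1 (a u0) 0 in das0.
  have c2 : 0 < c / 2 by lra.
  have /subspace_continuousP/(_ (u0, 0) (O0 _ uI))/cvgrPdist_le/(_ _ c2) := cder.
  rewrite near_withinE => /nbhs_ballP[r /= r0 rP].
  have [w w0 wu] : exists2 w : R, 0 < w & (w%:E < omega u0)%E.
    have := omega_gt0 _ uI; case: (omega u0) => [w| |] //.
      by rewrite lte_fin => w0; exists (w / 2); rewrite ?lte_fin; lra.
    by move=> _; exists 1; rewrite ?ltr01 ?ltry.
  have nw := lscN _ _ uI wu.
  near=> u d => /= uI' s s_ge0 sd.
  have d0 : 0 < d by near: d; exact: nbhs_right_gt.
  have dw : d < w by near: d; exact: nbhs_right_lt.
  have dr : d < r by near: d; exact: nbhs_right_lt.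
  have dc : d < c / 2 by near: d; exact: nbhs_right_lt.
  have dc' : d < (2 * c)^-1 by near: d; apply: nbhs_right_lt; rewrite invr_gt0; lra.
  have us : Omega omega (u, s).
    have wu' : (w%:E < omega u)%E by move: uI'; near: u.
    split => //=; rewrite (lt_trans _ wu') ?lte_fin ?(le_lt_trans sd) // andbT.
    by rewrite (lt_le_trans (y := 0%E)) ?lee_fin // oppe_lt0 omega_gt0.
  have ball_us : ball (u0, 0) r (u, s).
    split; rewrite /ball /=; last by rewrite sub0r normrN ger0_norm // (le_lt_trans sd).
    by near: u; exact: nbhsx_ballx.
  have : `|c - derive1 (a u) s| <= c / 2 := rP (u, s) ball_us us.
  rewrite ler_norml => /andP[h1 h2].
  split => //; first lra.
  rewrite -[leLHS]invrK lef_pV2 ?posrE //; last by rewrite invr_gt0; lra.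
  by apply: le_trans (ltW dc') _; rewrite lef_pV2 ?posrE; lra.
move=> nP.
have [d [d0 dP]] : exists d : R, 0 < d /\ `[0, 1] `<=` P d.
  have : \forall d \near (0 : R)^'+, 0 < d /\ `[0, 1] `<=` P d.
    by apply: filterI nP; exact: nbhs_right_gt.
  by move=> /filter_ex[d]; exists d.
have slope (u s t : R) : u \in `[0, 1] -> 0 <= s -> s <= t -> t <= d ->
    d * (t - s) <= a u t - a u s <= d^-1 * (t - s).
  move=> uI s_ge0; rewrite le_eqVlt => /predU1P[->|st] td.
    by rewrite !subrr !mulr0 lexx.
  have dv x : x \in `]s, t[ -> is_derive x 1 (a u) (derive1 (a u) x).
    rewrite in_itv /= => /andP[sx xt].
    have [ux _ _] := dP _ uI uI x (ltW (le_lt_trans s_ge0 sx)) (ltW (lt_le_trans xt td)).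
    by apply: (DeriveDef (dera _ _ ux)); rewrite derive1E.
  have cv : {within `[s, t], continuous (a u)}.
    apply: derivable_within_continuous => x; rewrite in_itv /= => /andP[sx xt].
    by have [ux _ _] := dP _ uI uI x (le_trans s_ge0 sx) (le_trans xt td); exact: dera.
  have [x] := MVT st dv cv; rewrite in_itv /= => /andP[sx xt] ->.
  have [_ l1 l2] := dP _ uI uI x (ltW (le_lt_trans s_ge0 sx)) (ltW (lt_le_trans xt td)).
  by rewrite !ler_wpM2r // subr_ge0 ltW.
have a0 (u : R) : u \in `[0, 1] -> a u 0 = 0.
  by move=> uI; have := odd _ _ (O0 _ uI); rewrite oppr0; lra.
exists d, d^-1, d; split; last by move=> u s t uI s0 st td; have /andP[] := slope _ _ _ uI s0 st td.
split => //.
- move=> u s us.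
  exact/differentiable_continuous/derivable1_diffP/dera.
- move=> T F FF x u s us xu xI; have [uI /= /andP[h1 h2]] := us.
  have n1 : \forall t \near F, (s%:E < omega (x t))%E.
    by have := xu _ (lscN _ _ uI h2); apply: filterS2 xI => t ? h; exact: h.
  have n2 : \forall t \near F, ((- s)%:E < omega (x t))%E.
    have h2' : ((- s)%:E < omega u)%E by rewrite EFinN lteNl.
    by have := xu _ (lscN _ _ uI h2'); apply: filterS2 xI => t ? h; exact: h.
  have Ox : \forall t \near F, Omega omega (x t, s).
    apply: filterS3 xI n1 n2 => t ? ? ?; split => //=.
    by apply/andP; split => //; rewrite lteNl -EFinN.
  split => //.
  have /subspace_continuousP/(_ (u, s) us) cus := cont.
  have xs : (x t, s) @[t --> F] --> within (Omega omega) (nbhs (u, s)).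
    move=> A; rewrite /within /= => nA.
    have : (x t, s) @[t --> F] --> (u, s) by exact: (cvg_pair xu (cvg_cst s)).
    by move=> /(_ _ nA); apply: filterS2 Ox => t ? h; exact: h.
  by move=> B nB; exact: (xs _ (cus B nB)).
- move=> u s uI s_ge0 sd; have [us _ _] := dP _ uI uI s s_ge0 sd.
  have /andP[] := slope u 0 s uI (lexx 0) s_ge0 sd.
  by rewrite a0 // !subr0.
Unshelve. all: by end_near.
Qed.

(** If [omega u] is infinite, the term eps s alone is unbounded; otherwise [a] is already unbounded,
    and eps s only helps for s >= 0. *)
Lemma a_plus_perturbed (omega : R -> \bar R) (a : R -> R -> R) (m M s0 eps u : R) :
  flux omega a m M s0 -> flux omega (fun u s => a u s + eps * s) m (M + eps) s0 ->
  0 < eps -> u \in `[0, 1] ->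
  ((omega u < +oo)%E -> a_plus omega a u = +oo%E) ->
  a_plus omega (fun u s => a u s + eps * s) u = +oo%E.
Proof.
move=> fa fe eps0 uI au; have O0 := Omega0 fa uI; have a0 := flux0 fa uI.
rewrite (a_plus_sup fe uI); apply: eq_infty => A.
suff [s us As] : exists2 s, Omega omega (u, s) & A <= a u s + eps * s.
  apply: (@le_trans _ _ (a u s + eps * s)%:E); first by rewrite lee_fin.
  by apply: ereal_sup_ubound; exists s.
have [ou|] := eqVneq (omega u) +oo%E.
  have us : Omega omega (u, `|A| / eps) by split => //=; rewrite ou ltNyr ltry.
  exists (`|A| / eps) => //; rewrite mulrCA mulfV ?gt_eqF // mulr1.
  have := flux_le fa O0 us; rewrite a0 divr_ge0 ?(ltW eps0) // => /(_ isT).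
  by have := ler_norm A; lra.
rewrite -ltey => /au aE.
have : (`|A|%:E < a_plus omega a u)%E by rewrite aE ltry.
rewrite (a_plus_sup fa uI) => /ereal_sup_gt[_ [s us <-]]; rewrite lte_fin => As.
exists s => //; have s_ge0 : 0 <= s.
  rewrite leNgt; apply/negP => s_lt0; have := flux_incr fa us O0 s_lt0.
  by have := normr_ge0 A; rewrite a0; lra.
by have := ler_norm A; have := mulr_ge0 (ltW eps0) s_ge0; lra.
Qed.

Lemma flux_perturbed (omega : R -> \bar R) (a : R -> R -> R) (m M s0 eps : R) :
  flux omega a m M s0 -> 0 < eps -> flux omega (fun u s => a u s + eps * s) m (M + eps) s0.
Proof.
move=> fa eps0; split.
- exact: (flux_m_gt0 fa).
- exact: (flux_s0_gt0 fa).
- by move=> u s t us ut st; rewrite ltrD ?(flux_incr fa) // ltr_pM2l.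
- by move=> u uI; rewrite (flux0 fa) // mulr0 addr0.
- move=> u s us; apply: cvgD; first exact: (flux_cont fa us).
  by apply: cvgM; [exact: cvg_cst|exact: cvg_id].
- move=> T F FF x u s us xu xI; have [ax Ox] := flux_cvg fa FF us xu xI.
  by split => //; apply: cvgD; [exact: ax|exact: cvg_cst].
- move=> u s uI s_ge0 ss; have [us l1 l2] := flux_small fa uI s_ge0 ss.
  by have := mulr_ge0 (ltW eps0) s_ge0; split => //; lra.
Qed.

End Regularity.

(** * Perturbation of the flux *)

Section Solutions.
Context {R : realType}.
Variables (H : R -> R -> R) (m M v0 : R) (f df : R -> R) (C sigma : R).
Hypotheses (Hrate : rate H m M v0) (Hf : reaction f df C).

Lemma ge0_at0 (V : R -> R) : {within `[0, 1], continuous V} ->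
  (forall u : R, u \in `]0, 1[ -> 0 < V u) -> 0 <= V 0.
Proof.
move=> /(continuous_within_itvP _ ltr01)[_ V0 _] Vpos.
apply: (cvgr_to_ge V0); near=> u; apply/ltW/Vpos; rewrite in_itv /=.
apply/andP; split; near: u; [exact: nbhs_right_gt|exact: nbhs_right_lt].
Unshelve. all: by end_near.
Qed.

Lemma solution_C1_oo (V : R -> R) :
  (forall u : R, u \in `]0, 1[ -> 0 < V u) ->
  (forall u : R, u \in `]0, 1[ -> is_derive u 1 V (sigma - f u * H u (V u))) ->
  C1_oo V 0 1.
Proof.
move=> Vpos dV; split; first by move=> u /dV[].
apply: continuous_in_subspaceT => u; rewrite inE /= => uI.
have uI' : u \in `[0, 1] by exact: subset_itv_oo_cc.
have uN : \forall x \near u, x \in `]0, 1[ by exact: near_in_itvoo.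
have dE x : x \in `]0, 1[ -> derive1 V x = sigma - f x * H x (V x).
  by move=> /dV[_]; rewrite derive1E.
have cont (F G : R -> R) (d : R) : is_derive u 1 F d -> F x @[x --> u] --> F u.
  by move=> [dF _]; exact/differentiable_continuous/derivable1_diffP.
rewrite /continuous_at dE //; apply: cvg_trans.
  apply: near_eq_cvg; apply: filterS uN => x xI; exact: (esym (dE x xI)).
apply: cvgB; first exact: cvg_cst.
apply: cvgM; first exact: (cont f f _ (reaction_derive Hf uI)).
apply: (rate_cvg Hrate) => //; first exact: Vpos.
  exact: (cont V V _ (dV _ uI)).
by apply: filterS uN => x; exact: subset_itv_oo_cc.
Qed.

End Solutions.

(** * Comparison of the rates of the original and the perturbed flux *)

Section Limit.
Context {R : realType}.
Variables (omega : R -> \bar R) (a : R -> R -> R) (m M s0 : R) (f df : R -> R) (C : R).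
Hypotheses (aflux : flux omega a m M s0) (Hf : reaction f df C)
  (slope : forall u s t : R, u \in `[0, 1] -> 0 <= s -> s <= t -> t <= s0 ->
    m * (t - s) <= a u t - a u s)
  (a_plus_infty : forall u : R, u \in `[0, 1] -> (omega u < +oo)%E ->
    a_plus omega a u = +oo%E).

Let ae eps u s := a u s + eps * s.
Let H := calH omega a.
Let He eps := calH omega (ae eps).

Let a_rate : rate H m M (m * s0) := flux_rate aflux a_plus_infty.

Lemma ae_flux eps : 0 < eps -> flux omega (ae eps) m (M + eps) s0.
Proof. exact: flux_perturbed. Qed.

Lemma ae_plus eps (u : R) : 0 < eps -> u \in `[0, 1] -> a_plus omega (ae eps) u = +oo%E.
Proof.
by move=> eps0 uI; apply: (a_plus_perturbed aflux (ae_flux eps0)) => //; exact: a_plus_infty.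
Qed.

Let ae_plus' eps (eps0 : 0 < eps) (u : R) (uI : u \in `[0, 1]) (_ : (omega u < +oo)%E) :=
  ae_plus eps0 uI.

Lemma ae_rate eps : 0 < eps -> rate (He eps) m (M + eps) (m * s0).
Proof. by move=> eps0; apply: flux_rate; [exact: ae_flux|exact: ae_plus']. Qed.

Lemma calH_le_perturbed eps (u v : R) : 0 < eps -> u \in `[0, 1] -> 0 < v -> H u v <= He eps u v.
Proof.
move=> eps0 uI v_gt0; rewrite leNgt; apply/negP => lt.
have H0 := le_lt_trans (rate_ge0 (ae_rate eps0) uI v_gt0) lt.
(* At s = 1/H(u, v), a + eps s < v would imply a < v, that is H(u, v) < H(u, v). *)
have Hi : 0 < (H u v)^-1 by rewrite invr_gt0.
move: lt; rewrite -[ltRHS]invrK => /(calH_ltP (ae_flux eps0) (ae_plus' eps0) uI v_gt0 Hi)[us asv].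
have : H u v < (H u v)^-1^-1.
  apply/(calH_ltP aflux a_plus_infty uI v_gt0 Hi); split => //.
  by have := mulr_gt0 eps0 Hi; move: asv; rewrite /ae; lra.
by rewrite invrK ltxx.
Qed.

(** With t = 1/H^eps and s = (1 + eps/m) t, the slope bound gives a(s) - a(t) >= m (s - t) = eps t.
    If the claim failed, then a(s) < v, hence a(t) + eps t < v, contradicting the choice of t. *)
Lemma calH_perturbed_le eps (u v : R) : 0 < eps -> u \in `[0, 1] -> 0 < v -> v <= m * s0 ->
  He eps u v <= (1 + eps / m) * H u v.
Proof.
move=> eps0 uI v_gt0 vs.
have m0 := flux_m_gt0 aflux; have s00 := flux_s0_gt0 aflux.
have k0 : 0 < 1 + eps / m by rewrite ltr_wpDr // divr_ge0 // ltW.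
set k := 1 + eps / m in k0 *.
rewrite leNgt; apply/negP => lt.
have Hlow := rate_ge a_rate uI v_gt0 vs.
have H0 : 0 < H u v by apply: lt_le_trans Hlow; exact: divr_gt0.
have He0 : 0 < He eps u v by apply: lt_trans lt; exact: mulr_gt0.
pose s := k / He eps u v.
have s_gt0 : 0 < s by exact: divr_gt0.
have Hs : H u v < s^-1 by rewrite /s invf_div ltr_pdivlMr // mulrC.
have ss : s <= s0.
  rewrite -[s]invrK -[s0]invrK lef_pV2 ?posrE ?invr_gt0 //.
  apply: le_trans (ltW Hs); apply: le_trans Hlow.
  by rewrite ler_pdivlMr // mulrC ler_pdivrMr.
have [us asv] := (calH_ltP aflux a_plus_infty uI v_gt0 s_gt0).1 Hs.
pose t := (He eps u v)^-1.
have t_gt0 : 0 < t by rewrite invr_gt0.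
have st : s = t + eps / m * t by rewrite /s /k mulrDl mul1r.
have ts : t <= s by rewrite st lerDl mulr_ge0 ?divr_ge0 ?(ltW t_gt0) ?(ltW m0) // ltW.
have := slope uI (ltW t_gt0) ts ss.
have -> : m * (s - t) = eps * t by rewrite st; field; rewrite gt_eqF.
move=> sl.
have : He eps u v < t^-1.
  apply/(calH_ltP (ae_flux eps0) (ae_plus' eps0) uI v_gt0 t_gt0); split.
    exact: Omega_between (Omega0 aflux uI) us (ltW t_gt0) ts.
  by rewrite /ae; lra.
by rewrite /t invrK ltxx.
Qed.

(** Compactness of [0, 1] makes the claim local in u. Near points with V < m s0 the excess is at
    most (eps/m) f H(u, V) <= (eps/m) M L; near the others both rates stay close to H at the
    centre. *)
Lemma perturbed_reaction_close (V dV : R -> R) (L eta : R) : 0 < L -> 0 < eta ->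
  {within `[0, 1], continuous V} -> V 0 = 0 -> V 1 = 0 ->
  (forall u : R, u \in `]0, 1[ -> 0 < V u) ->
  (forall u : R, u \in `]0, 1[ -> is_derive u 1 V (dV u)) ->
  (forall u : R, u \in `]0, 1[ -> f u <= L * V u) ->
  \forall eps \near (0 : R)^'+, forall u : R, u \in `]0, 1[ ->
    f u * He eps u (V u) <= f u * H u (V u) + eta.
Proof.
move=> L0 eta0 cV V0 V1 Vpos dVE fLV.
have m0 := flux_m_gt0 aflux; have s00 := flux_s0_gt0 aflux; have C0 := reaction_C_ge0 Hf.
have M0 : 0 <= M by exact: rate_M_ge0 a_rate.
pose P (eps u : R) := u \in `]0, 1[ -> f u * He eps u (V u) <= f u * H u (V u) + eta.
suff : \forall eps \near (0 : R)^'+, `[0, 1] `<=` P eps.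
  by apply: filterS => eps h u uI; apply: (h u) => //; exact: subset_itv_oo_cc.
apply: (compact_near_coveringP _).1 (@segment_compact R 0 1) _ _ _ _ _ => u0 uI0.
have [Vs|Vs] := ltP (V u0) (m * s0).
  have Vn : \forall u \near u0, u \in `[0, 1] -> V u < m * s0.
    have /subspace_continuousP/(_ u0 uI0) cVu := cV.
    have : \forall u \near within `[0, 1] (nbhs u0), V u < m * s0.
      exact: (cvgr_lt _ cVu).
    by rewrite near_withinE.
  have K0 : 0 < m^-1 * (M * L) + 1 by rewrite ltr_wpDl // mulr_ge0 ?invr_ge0 ?mulr_ge0 // ltW.
  near=> u eps => /= uI.
  have uI' : u \in `[0, 1] by exact: subset_itv_oo_cc.
  have eps0 : 0 < eps by near: eps; exact: nbhs_right_gt.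
  have epsK : eps < eta / (m^-1 * (M * L) + 1).
    by near: eps; apply: nbhs_right_lt; exact: divr_gt0.
  have fu := reaction_gt0 Hf uI; have Vu := Vpos _ uI.
  have Vus : V u <= m * s0 by apply: ltW; move: uI'; near: u.
  apply: (@le_trans _ _ (f u * ((1 + eps / m) * H u (V u)))).
    by rewrite ler_wpM2l ?(ltW fu) // calH_perturbed_le.
  have fH : f u * H u (V u) <= M * L.
    apply: (@le_trans _ _ (f u * (M / V u))).
      by rewrite ler_wpM2l ?(ltW fu) // (rate_le a_rate).
    by rewrite mulrCA ler_wpM2l // ler_pdivrMr // fLV.
  rewrite mulrCA mulrDl mul1r lerD2l.
  move: epsK; rewrite ltr_pdivlMr // mulrDr mulr1 => epsK.
  apply: (@le_trans _ _ (eps / m * (M * L))).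
    by rewrite ler_wpM2l // divr_ge0 // ltW.
  by rewrite -mulrA; lra.
(* V vanishes at 0 and 1, so V(u0) >= m s0 > 0 places u0 in the interior. *)
have uI : u0 \in `]0, 1[.
  have ms : 0 < m * s0 by exact: mulr_gt0.
  move: uI0; rewrite /= !in_itv /= !lt_def => /andP[-> ->]; rewrite !andbT.
  by apply/andP; split; apply/eqP => u0E; move: Vs;
    [rewrite u0E V0|rewrite -u0E V1]; rewrite leNgt ms.
have Vu0 := Vpos _ uI.
have V_cvg : V x @[x --> u0] --> V u0.
  by have [dVu _] := dVE _ uI; exact/differentiable_continuous/derivable1_diffP.
have uN : \forall x \near u0, x \in `]0, 1[ by exact: near_in_itvoo.
have uN' : \forall x \near u0, x \in `[0, 1].
  by apply: filterS uN => x; exact: subset_itv_oo_cc.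
(* Both rates will lie within [d] of [h0] on the relevant side, and f <= C, so the difference of the
   products is at most 2 C d <= eta. *)
set h0 := H u0 (V u0); pose d := eta / (2 * (C + 1)).
have d0 : 0 < d by rewrite divr_gt0 // mulr_gt0 // ltr_wpDl.
have h0_ge0 : 0 <= h0 by exact: (rate_ge0 a_rate uI0 Vu0).
have Hlow : \forall u \near u0, h0 - d < H u (V u).
  have := rate_cvg a_rate (nbhs_filter u0) uI0 Vu0 (@cvg_id _ _) V_cvg uN'.
  by move=> /cvgr_gt; apply; rewrite gtrBl.
pose s := (h0 + d)^-1.
have s_gt0 : 0 < s by rewrite invr_gt0 ltr_wpDl.
have [us asv] : Omega omega (u0, s) /\ a u0 s < V u0.
  by apply/(calH_ltP aflux a_plus_infty uI0 Vu0 s_gt0); rewrite /s invrK ltrDl.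
have [acvg aO] := flux_cvg aflux (nbhs_filter u0) us (@cvg_id _ _) uN'.
(* One third each for the variation of a(u, s), for that of V, and for eps s. *)
pose gap := (V u0 - a u0 s) / 3.
have gap0 : 0 < gap by rewrite divr_gt0 // subr_gt0.
have a_lt : \forall u \near u0, a u s < a u0 s + gap by apply: (cvgr_lt _ acvg); rewrite ltrDl.
have V_gt : \forall u \near u0, V u0 - gap < V u by apply: (cvgr_gt _ V_cvg); rewrite gtrBl.
near=> u eps => /= uI1.
have uI1' : u \in `[0, 1] by exact: subset_itv_oo_cc.
have eps0 : 0 < eps by near: eps; exact: nbhs_right_gt.
have eps1 : eps < gap / s by near: eps; apply: nbhs_right_lt; exact: divr_gt0.
have Hup : He eps u (V u) < h0 + d.
  rewrite -[h0 + d]invrK; apply/(calH_ltP (ae_flux eps0) (ae_plus' eps0) uI1' (Vpos _ uI1) s_gt0).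
  split; first by near: u.
  have : a u s < a u0 s + gap by near: u.
  have : V u0 - gap < V u by near: u.
  move: eps1; rewrite ltr_pdivlMr // /ae.
  have : gap * 3 = V u0 - a u0 s by rewrite /gap; field.
  by lra.
have Hlo : h0 - d < H u (V u) by near: u.
have fu := ltW (reaction_gt0 Hf uI1).
have fC : f u <= C.
  apply: le_trans (reaction_le_dist1 Hf uI1') _.
  rewrite -[leRHS]mulr1 ler_wpM2l // gerBl.
  by move: uI1'; rewrite in_itv /= => /andP[].
rewrite -lerBlDl -mulrBr; apply: (@le_trans _ _ (C * (2 * d))).
  apply: (@le_trans _ _ (f u * (2 * d))); first by rewrite ler_wpM2l //; lra.
  by rewrite ler_wpM2r // mulr_ge0 // ltW.
have dE : (C + 1) * (2 * d) = eta.
  by rewrite /d; field; rewrite gt_eqF // ltr_wpDl.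
by rewrite -dE ler_wpM2r ?lerDl // mulr_ge0 // ltW.
Unshelve. all: by end_near.
Qed.

End Limit.

(** * Critical speeds *)

Section CriticalSpeeds.
Context {R : realType}.
Variables (omega : R -> \bar R) (a : R -> R -> R) (m M s0 : R) (f df : R -> R) (C : R).
Hypotheses (aflux : flux omega a m M s0) (Hf : reaction f df C)
  (slope : forall u s t : R, u \in `[0, 1] -> 0 <= s -> s <= t -> t <= s0 ->
    m * (t - s) <= a u t - a u s)
  (a_plus_infty : forall u : R, u \in `[0, 1] -> (omega u < +oo)%E ->
    a_plus omega a u = +oo%E).

Let ae eps u s := a u s + eps * s.
Let H := calH omega a.
Let He eps := calH omega (ae eps).
Let a_rate : rate H m M (m * s0) := flux_rate aflux a_plus_infty.
Let i0 : (0 : R) \in `[0, 1]. Proof. by rewrite in_itv /= lexx ler01. Qed.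

Definition speeds : set R :=
  [set sigma | 0 <= sigma /\ exists V, is_calV omega a f sigma V /\ V 0 = 0].

Definition perturbed_speeds eps : set R :=
  [set sigma | [/\ 0 < sigma, alpha_ omega (ae eps) f sigma = 0 &
    exists V, is_V omega (ae eps) f sigma (alpha_ omega (ae eps) f sigma) V /\
              V u @[u --> 0^'+] --> (0 : R)]].

Lemma is_calV_derive (sigma : R) V : is_calV omega a f sigma V ->
  forall u : R, u \in `]0, 1[ -> is_derive u 1 V (sigma - f u * H u (V u)).
Proof.
move=> [_ [dV _] _ _ VE] u uI; apply: (DeriveDef (dV _ uI)).
by rewrite -derive1E VE.
Qed.

Lemma calV_exists (sigma : R) : 0 <= sigma -> exists L V,
  [/\ 0 < L, is_calV omega a f sigma V & forall u : R, u \in `]0, 1[ -> f u <= L * V u].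
Proof.
move=> sigma0.
have [L [V [L0 cV V1 fLV dV]]] := singular_solution_exists a_rate Hf sigma0.
have Vpos (u : R) : u \in `]0, 1[ -> 0 < V u.
  by move=> uI; rewrite -(pmulr_rgt0 _ L0) (lt_le_trans (reaction_gt0 Hf uI)) // fLV.
exists L, V; split => //; split => //; first exact: (solution_C1_oo a_rate Hf Vpos dV).
by move=> u /dV[_]; rewrite derive1E.
Qed.

Lemma calV_eq0 (sigma : R) (V W dW : R -> R) : is_calV omega a f sigma V ->
  {within `[0, 1], continuous W} ->
  (forall u : R, u \in `]0, 1[ -> is_derive u 1 W (dW u)) ->
  (forall u : R, u \in `]0, 1[ -> 0 < W u) ->
  (forall u : R, u \in `]0, 1[ -> dW u <= sigma - f u * H u (W u)) ->
  0 <= W 1 -> W 0 <= 0 -> V 0 = 0.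
Proof.
move=> VP cW dWE Wpos dWle W1 W0; have [cV _ V1 Vpos _] := VP.
apply/eqP; rewrite eq_le (ge0_at0 cV Vpos) andbT; apply: le_trans W0.
by apply: (le_supersolution a_rate Hf cV (is_calV_derive VP) cW dWE) => //; rewrite V1.
Qed.

(** The linear function l u is a supersolution for a large speed: with l = m s0 it stays where H <=
    M/v, and f <= C u gives f H(u, l u) <= C M/l. *)
Lemma speeds_nonempty : exists sigma, speeds sigma.
Proof.
have m0 := flux_m_gt0 aflux; have s00 := flux_s0_gt0 aflux; have C0 := reaction_C_ge0 Hf.
have M0 : 0 <= M by exact: rate_M_ge0 a_rate.
pose l := m * s0; have l0 : 0 < l by exact: mulr_gt0.
pose sigma := l + C * (M / l).
have CM0 : 0 <= C * (M / l) by rewrite mulr_ge0 // divr_ge0 // ltW.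
have sigma0 : 0 <= sigma by rewrite addr_ge0 // ltW.
have [_ [V [_ VP _]]] := calV_exists sigma0.
exists sigma; split => //; exists V; split => //.
have dlin (u : R) : u \in `]0, 1[ -> is_derive u 1 (fun x => l * x - 0) (l * 1 - 0).
  by move=> _; apply: (@is_derive_lin _ id (cst 0)).
apply: (calV_eq0 VP _ dlin).
- apply: continuous_subspaceT => x; apply: cvgB; last exact: cvg_cst.
  by apply: cvgM; [exact: cvg_cst|exact: cvg_id].
- by move=> u; rewrite in_itv /= subr0 => /andP[u0 _]; rewrite mulr_gt0.
- move=> u uI; rewrite !subr0 mulr1.
  have uI' : u \in `[0, 1] by exact: subset_itv_oo_cc.
  move: (uI); rewrite in_itv /= => /andP[u0 u1].
  have lu : 0 < l * u by exact: mulr_gt0.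
  have lul : l * u <= m * s0 by rewrite -/l -[leRHS]mulr1 ler_wpM2l // ltW.
  have := rate_le a_rate uI' lu lul.
  have : f u * H u (l * u) <= C * u * (M / (l * u)).
    apply: ler_pM; rewrite ?(ltW (reaction_gt0 Hf uI)) ?(rate_ge0 a_rate) //.
      exact: (reaction_le_dist0 Hf uI').
    exact: (rate_le a_rate).
  have -> : C * u * (M / (l * u)) = C * (M / l) by field; rewrite !gt_eqF.
  by rewrite /sigma; lra.
- by rewrite mulr1 subr0 ltW.
- by rewrite mulr0 subr0.
Qed.

(** For an admissible sigma close to the infimum with profile W, the function W + d (1 - u), d =
    sigma - inf, is a supersolution at the infimum speed. Its value d at u = 0 is arbitrarily
    small. *)
Lemma speeds_inf : speeds (inf speeds).
Proof.
have [sigma1 sP1] := speeds_nonempty.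
have hinf : has_inf speeds by split; [exists sigma1|exists 0 => sigma []].
have s_ge0 : 0 <= inf speeds by apply: lb_le_inf; [exists sigma1|move=> sigma []].
have [_ [V [_ VP _]]] := calV_exists s_ge0.
split => //; exists V; split => //; have [cV _ V1 Vpos _] := VP.
apply/eqP; rewrite eq_le (ge0_at0 cV Vpos) andbT; apply/ler_addgt0Pr => e e0; rewrite add0r.
have [sigma [sigma0 [W [WP W0]]] sigma_lt] := inf_adherent e0 hinf.
have sigma_ge : inf speeds <= sigma by apply: ge_inf; [exact: hinf.2|split => //; exists W].
have [cW _ W1 Wpos _] := WP.
pose d := sigma - inf speeds; have d0 : 0 <= d by rewrite subr_ge0.
pose W' x := 1 * W x - (d * x - d).
pose dW' x := 1 * (sigma - f x * H x (W x)) - (d * 1 - 0).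
have dlin (u : R) : is_derive u 1 (fun x => d * x - d) (d * 1 - 0).
  by apply: (@is_derive_lin _ id (cst d)).
have clin : {within `[0, 1], continuous (fun x : R => d * x - d)}.
  apply: continuous_subspaceT => x; apply: cvgB; last exact: cvg_cst.
  by apply: cvgM; [exact: cvg_cst|exact: cvg_id].
have cW' : {within `[0, 1], continuous W'} by exact: continuous_lin.
have dW'E (u : R) : u \in `]0, 1[ -> is_derive u 1 W' (dW' u).
  by move=> uI; exact: (is_derive_lin 1 (is_calV_derive WP uI) (dlin u)).
have WW' (u : R) : u \in `]0, 1[ -> W u <= W' u.
  rewrite in_itv /= /W' => /andP[_ u1]; rewrite mul1r lerBrDr gerDl.
  by rewrite -[X in _ - X]mulr1 -mulrBr mulr_ge0_le0 // subr_le0 ltW.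
have W'pos (u : R) : u \in `]0, 1[ -> 0 < W' u.
  by move=> uI; apply: lt_le_trans (WW' _ uI); exact: Wpos.
have dW'le (u : R) : u \in `]0, 1[ -> dW' u <= inf speeds - f u * H u (W' u).
  move=> uI; have uI' : u \in `[0, 1] by exact: subset_itv_oo_cc.
  have : f u * H u (W' u) <= f u * H u (W u).
    by rewrite ler_wpM2l ?(ltW (reaction_gt0 Hf uI)) // (rate_noninc a_rate) ?Wpos ?WW'.
  by rewrite /dW' /d; lra.
have VW1 : V 1 <= W' 1 by rewrite /W' V1 W1 mulr0 mulr1 !subrr.
have := le_supersolution a_rate Hf cV (is_calV_derive VP) cW' dW'E W'pos dW'le VW1 i0.
by rewrite /W' W0 /d => h; apply: (le_trans h); lra.
Qed.

Lemma sigma_s_inf : sigma_s omega a f = inf speeds.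
Proof.
have hlb : has_lbound speeds by exists 0 => sigma [].
have [gP glb] : (speeds `&` lbound speeds) (sigma_s omega a f).
  apply: (@getPex _ (speeds `&` lbound speeds)); exists (inf speeds).
  by split; [exact: speeds_inf|move=> sigma sP; exact: ge_inf].
by apply/eqP; rewrite eq_le glb ?ge_inf //; exact: speeds_inf.
Qed.

(** Since H <= H^eps, a perturbed profile is a supersolution of the original equation at the same
    speed. *)
Lemma perturbed_speeds_sub eps : 0 < eps -> perturbed_speeds eps `<=` speeds.
Proof.
move=> eps0 sigma [sigma0 alpha0 [V [+ V0]]]; rewrite alpha0 => -[cV [dV _] V1 VP].
split; first exact: ltW.
have [_ [U [_ UP _]]] := calV_exists (ltW sigma0).
exists U; split => //.
(* Only the right limit of [V] at 0 is known to vanish; its value there is arbitrary, so it is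
   replaced by 0 to get continuity on [0, 1]. *)
pose W (u : R) := if u <= 0 then 0 else V u.
have WV (u : R) : 0 < u -> W u = V u by rewrite /W ltNge => /negbTE ->.
have WVn (u : R) : 0 < u -> \forall x \near u, V x = W x.
  by move=> u0; near=> x; rewrite WV //; near: x; exact: lt_nbhsr.
pose dW u := sigma - f u * He eps u (W u).
have dVE (u : R) : u \in `]0, 1[ -> is_derive u 1 V (dW u).
  move=> uI; have [Vu Va VE] := VP _ uI.
  have u0 : 0 < u by move: uI; rewrite in_itv /= => /andP[].
  apply: (DeriveDef (dV _ uI)); rewrite -derive1E VE /dW WV // /He /calH.
  by rewrite /ae Va.
have dWE (u : R) : u \in `]0, 1[ -> is_derive u 1 W (dW u).
  move=> uI; apply: near_eq_is_derive (dVE _ uI); apply: WVn.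
  by move: uI; rewrite in_itv /= => /andP[].
have W0 : W 0 = 0 by rewrite /W lexx.
apply: (calV_eq0 UP _ dWE).
- apply/(continuous_within_itvP _ ltr01); split.
  + move=> u /dWE[dWu _]; exact/differentiable_continuous/derivable1_diffP.
  + rewrite W0; apply: cvg_trans V0; apply: near_eq_cvg.
    by near=> x; rewrite WV //; near: x; exact: nbhs_right_gt.
  + rewrite WV //; have cV1 : {within `[2^-1, 1], continuous V}.
      apply: continuous_subspaceW cV => x /=; rewrite !in_itv /= => /andP[x0 ->].
      by rewrite andbT; lra.
    have h1 : (2^-1 : R) < 1 by lra.
    have [_ _ V1c] := (continuous_within_itvP _ h1).1 cV1.
    apply: cvg_trans V1c; apply: near_eq_cvg.
    by near=> x; rewrite WV //; near: x; apply: nbhs_left_gt.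
- move=> u uI; have [Vu _ _] := VP _ uI; rewrite WV //.
  by move: uI; rewrite in_itv /= => /andP[].
- move=> u uI; have uI' : u \in `[0, 1] by exact: subset_itv_oo_cc.
  have [Vu _ _] := VP _ uI.
  have u0 : 0 < u by move: uI; rewrite in_itv /= => /andP[].
  rewrite /dW lerD2l lerN2 ler_wpM2l ?(ltW (reaction_gt0 Hf uI)) //.
  by apply: (calH_le_perturbed aflux) => //; rewrite WV.
- by rewrite WV // V1.
- by rewrite W0.
Unshelve. all: by end_near.
Qed.

Lemma near_perturbed_speeds (eta : R) : 0 < eta ->
  \forall eps \near (0 : R)^'+, perturbed_speeds eps (inf speeds + eta).
Proof.
move=> eta0; have [s_ge0 [W [WP W0]]] := speeds_inf.
have [cW _ W1 Wpos _] := WP.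
have [L [V [L0 VP fLV]]] := calV_exists s_ge0.
have [cV _ V1 Vpos _] := VP; have dVE := is_calV_derive VP.
(* [W] vanishes at 0 and [V] satisfies f <= L V; comparing them provides one profile with both
   properties. *)
have V0 : V 0 = 0.
  by apply: (calV_eq0 VP cW (is_calV_derive WP) Wpos) => [//||]; rewrite ?W1 ?W0.
set sigma := inf speeds + eta.
have sigma0 : 0 < sigma by rewrite ltr_wpDl.
have close := perturbed_reaction_close aflux Hf slope a_plus_infty L0 eta0 cV V0 V1 Vpos dVE fLV.
near=> eps.
have eps0 : 0 < eps by near: eps; exact: nbhs_right_gt.
have closeE (u : R) : u \in `]0, 1[ -> f u * He eps u (V u) <= f u * H u (V u) + eta.
  by move: u; near: eps.
have e_rate : rate (He eps) m (M + eps) (m * s0) := ae_rate aflux a_plus_infty eps0.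
have [L' [U [L'0 cU U1 fLU dU]]] := singular_solution_exists e_rate Hf (ltW sigma0).
have Upos (u : R) : u \in `]0, 1[ -> 0 < U u.
  by move=> uI; rewrite -(pmulr_rgt0 _ L'0) (lt_le_trans (reaction_gt0 Hf uI)) // fLU.
have U0 : U 0 = 0.
  apply/eqP; rewrite eq_le (ge0_at0 cU Upos) andbT.
  suff : U 0 <= V 0 by rewrite V0.
  apply: (le_supersolution e_rate Hf cU dU cV dVE Vpos) => //; last by rewrite U1 V1.
  by move=> u uI; have := closeE _ uI; rewrite /sigma; lra.
(* The perturbed a_+ is infinite, so [calH] is 1/g everywhere and the extended equation coincides
   with the one in [is_V]. *)
have UP : is_V omega (ae eps) f sigma 0 U.
  split => //.
  - by apply: continuous_subspaceW cU => x /=; rewrite !in_itv /= => /andP[/ltW -> ->].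
  - exact: (solution_C1_oo e_rate Hf Upos dU).
  - move=> u uI; have uI' : u \in `[0, 1] by exact: subset_itv_oo_cc.
    have ap : a_plus omega (ae eps) u = +oo%E by exact: (ae_plus aflux a_plus_infty eps0 uI').
    split; [exact: Upos|by rewrite ap ltry|].
    have [_] := dU _ uI; rewrite derive1E => ->.
    by rewrite /He /calH ap ltry.
have alpha0 : alpha_ omega (ae eps) f sigma = 0.
  set A := [set alpha | 0 <= alpha < 1 /\ exists V, is_V omega (ae eps) f sigma alpha V].
  have A0 : A 0 by split; [rewrite lexx ltr01|exists U].
  have A_ge0 : lbound A 0 by move=> x [/andP[]].
  have [gA glb] : (A `&` lbound A) (minimum A).
    by apply: (@getPex _ (A `&` lbound A)); exists 0.
  by apply/eqP; rewrite eq_le glb //=; exact: A_ge0.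
split => //; rewrite alpha0; exists U; split => //.
have [_ + _] := (continuous_within_itvP _ ltr01).1 cU.
by rewrite U0.
Unshelve. all: by end_near.
Qed.

Lemma sigma_r_cvg :
  sigma_r omega (ae eps) f @[eps --> 0^'+] --> (sigma_s omega a f)%:E.
Proof.
have lower eps : 0 < eps -> ((inf speeds)%:E <= sigma_r omega (ae eps) f)%E.
  move=> eps0; apply: le_ereal_inf_tmp => _ [sigma sP <-]; rewrite lee_fin.
  by apply: ge_inf; [exists 0 => ? []|exact: perturbed_speeds_sub sP].
have upper eta : 0 < eta ->
    \forall eps \near (0 : R)^'+, (sigma_r omega (ae eps) f <= (inf speeds + eta)%:E)%E.
  move=> /near_perturbed_speeds; apply: filterS => eps sP.
  by apply: ereal_inf_lbound; exists (inf speeds + eta).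
rewrite sigma_s_inf; apply: cvg_EFin.
  near=> eps; rewrite fin_real //; apply/andP; split.
    by apply: (@lt_le_trans _ _ (inf speeds)%:E); rewrite ?ltNyr // lower.
  apply: (@le_lt_trans _ _ (inf speeds + 1)%:E); last exact: ltry.
  by near: eps; exact: upper.
apply/cvgrPdist_le => e e0; near=> eps => /=.
have lo : ((inf speeds)%:E <= sigma_r omega (ae eps) f)%E by apply: lower.
have up : (sigma_r omega (ae eps) f <= (inf speeds + e)%:E)%E by near: eps; exact: upper.
move: lo up; case: (sigma_r _ _ _) => [r| |]; rewrite ?lee_fin //=.
by move=> ? ?; rewrite ler_norml; apply/andP; split; lra.
Unshelve. all: by end_near.
Qed.

End CriticalSpeeds.

Theorem theorem4p1 (R : realType) (omega : R -> \bar R) (a : R -> R -> R)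
    (f : R -> R)
  (omega_gt0 : forall u : R, u \in `[0, 1] -> (0 < omega u)%E)
  (omega_lsc : lower_semicontinuous (omega : subspace `[0, 1] -> \bar R))
  (a_cont : {within Omega omega, continuous (fun p : R * R => a p.1 p.2)})
  (a_odd : forall u s : R, Omega omega (u, s) -> a u (- s) = - a u s)
  (a_incr : forall u s t : R, Omega omega (u, s) -> Omega omega (u, t) ->
    s < t -> a u s < a u t)
  (a_plus_infty : forall u : R, u \in `[0, 1] ->
    (omega u < +oo)%E -> a_plus omega a u = +oo%E)
  (f_C1 : C1_on `[0, 1] f)
  (f0 : f 0 = 0) (f1 : f 1 = 0)
  (f_gt0 : forall u : R, u \in `]0, 1[ -> 0 < f u)
  (a_C1 : C1_Omega omega a)
  (das_gt0 : forall u s : R, Omega omega (u, s) -> 0 < derive1 (a u) s)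
  (a_plus_cont : {within `[0, 1], continuous (a_plus omega a)}) :
  sigma_r omega (fun u s => a u s + eps * s) f @[eps --> 0^'+]
    --> (sigma_s omega a f)%:E.
Proof.
have [df [C Hf]] := reaction_of_C1 f_C1 f0 f1 f_gt0.
have [m [M [s0 [aflux slope]]]] :=
  flux_of_C1 omega_gt0 omega_lsc a_cont a_odd a_incr a_C1 das_gt0.
exact: (sigma_r_cvg aflux Hf slope a_plus_infty).
Qed.
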